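(* Let $g\ge 1$ and $k\ge 1$ be integers. Then $$\dim (H_{\mathbb Q}^{\otimes 2k})^{\mathrm{Sp}}=\sum_{|\lambda|=k,\ h(\lambda)\le g}\dim(\lambda^\delta)_{\mathfrak S_{2k}},$$ where the sum is over all Young diagrams $\lambda$ with $k$ boxes and at most $g$ rows.
   Context: $H_{\mathbb Q}$ is the standard symplectic $\mathbb Q$-vector space of dimension $2g$, $\mathrm{Sp}=\mathrm{Sp}(2g,\mathbb Q)$ is its automorphism group, and $(H_{\mathbb Q}^{\otimes 2k})^{\mathrm{Sp}}$ is the subspace of invariants of the diagonal $\mathrm{Sp}$-action on $H_{\mathbb Q}^{\otimes 2k}$. A Young diagram $\lambda=[\lambda_1\cdots\lambda_h]$ ($\lambda_1\ge\cdots\ge\lambda_h\ge1$) has $|\lambda|=\lambda_1+\cdots+\lambda_h$ boxes and $h(\lambda)=h$ rows. For $|\nu|=d$, $\nu_{\mathfrak S_d}$ is the irreducible representation over $\mathbb Q$ of the symmetric group $\mathfrak S_d$ corresponding to $\nu$ (convention: $[d]_{\mathfrak S_d}$ trivial). For $|\lambda|=k$, $\lambda^\delta=[\lambda_1\lambda_1\lambda_2\lambda_2\cdots\lambda_h\lambda_h]$, a Young diagram with $2k$ boxes. *)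

(* Defs.v *)
From HB Require Import structures.
From mathcomp Require Import all_boot all_order all_algebra all_fingroup.
From mathcomp Require Import mxrepresentation.
From mathcomp.real_closed Require Import mxtens.
From mathcomp.classical Require Import boolp.

Set Implicit Arguments.
Unset Strict Implicit.
Unset Printing Implicit Defensive.

Import GRing.Theory.
Local Open Scope ring_scope.

Section Symplectic.
Variable g : nat.

(* H_Q = Q^2g is the space 'rV[rat]_(g + g), linear maps acting on the right;
   'e_0, ..., 'e_(2g-1) is the symplectic basis x_1, .., x_g, y_1, .., y_g. *)
Definition symp_mx : 'M[rat]_(g + g) := block_mx 0 1%:M (- 1%:M) 0.

Definition symp_form (u v : 'rV[rat]_(g + g)) : rat :=
  (u *m symp_mx *m v^T) 0 0.

Definition Sp (A : 'M[rat]_(g + g)) : Prop :=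
  A \in unitmx /\
  forall u v : 'rV[rat]_(g + g), symp_form (u *m A) (v *m A) = symp_form u v.

(* H_Q^{(x) n} is 'rV_((g + g) ^ n), with pure tensors u_1 *t (... *t u_n);
   by tensmx_mul, A ^t n maps such a tensor to the tensor of the u_i *m A. *)
Definition Sp_invariant n (v : 'rV[rat]_((g + g) ^ n)) : Prop :=
  forall A : 'M[rat]_(g + g), Sp A -> v *m (A ^t n) = v.

End Symplectic.

Lemma vspace_of_closed (F : fieldType) (vT : vectType F) (P : vT -> Prop) :
    P 0 -> (forall (a : F) u v, P u -> P v -> P (a *: u + v)) ->
  exists U : {vspace vT}, forall v, v \in U <-> P v.
Proof.
move=> P0 Plin.
pose Q n := `[< exists2 U : {vspace vT}, \dim U = n & forall v, v \in U -> P v >].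
have exQ : exists n, Q n.
  exists 0%N; apply/asboolP; exists 0%VS; first by rewrite dimv0.
  by move=> v; rewrite memv0 => /eqP->.
have ubQ n : Q n -> (n <= \dim {: vT})%N.
  by move=> /asboolP[U <- _]; rewrite dimvS ?subvf.
case: (ex_maxnP exQ ubQ) => n /asboolP[U dimU UP] maxU.
exists U => v; split=> [|Pv]; first exact: UP.
have /maxU : Q (\dim (<[v]> + U)%VS).
  apply/asboolP; exists (<[v]> + U)%VS => // w /memv_addP[_ /vlineP[a ->]].
  by case=> u Uu ->; apply: Plin => //; apply: UP.
rewrite -dimU => le_dim.
have /eqP-> : U == (<[v]> + U)%VS by rewrite eqEdim addvSr.
by rewrite (subvP (addvSl _ _)) ?memv_line.
Qed.

Lemma Sp_invariants_ex g n :
  exists U : {vspace 'rV[rat]_((g + g) ^ n)}, forall v, v \in U <-> Sp_invariant v.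
Proof.
apply: vspace_of_closed => [A _|a u v Pu Pv A SpA]; first by rewrite mul0mx.
by rewrite mulmxDl -scalemxAl Pu ?Pv.
Qed.

(* Sp is infinite, so its invariants are obtained as a {vspace _} by choice;
   Sp_invariantsP determines this subspace. *)
Definition Sp_invariants g n : {vspace 'rV[rat]_((g + g) ^ n)} :=
  sval (cid (Sp_invariants_ex g n)).

Lemma Sp_invariantsP g n (v : 'rV[rat]_((g + g) ^ n)) :
  v \in Sp_invariants g n <-> Sp_invariant v.
Proof. exact: (svalP (cid (Sp_invariants_ex g n))). Qed.

Definition is_young_diagram (d : nat) (rows : seq nat) : bool :=
  [&& sorted geq rows, 0%N \notin rows & sumn rows == d].

Record young_diagram (d : nat) : predArgType :=
  YoungDiagram { yd_rows :> seq nat; _ : is_young_diagram d yd_rows }.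

HB.instance Definition _ d := [isSub for @yd_rows d].
HB.instance Definition _ d := [Choice of young_diagram d by <:].

Section YoungFinite.
Variable d : nat.

Definition yd_code (nu : young_diagram d) : d.-bseq 'I_d.+1 :=
  insub_bseq d [seq inord r | r <- nu].
Definition yd_decode (t : d.-bseq 'I_d.+1) : option (young_diagram d) :=
  insub [seq val r | r <- t].

Lemma yd_codeK : pcancel yd_code yd_decode.
Proof.
move=> nu; have /and3P[_ nu0 /eqP sum_nu] := valP nu.
have size_nu : (size nu <= d)%N.
  suff: (size (val nu) <= sumn (val nu))%N by rewrite sum_nu.
  elim: (val nu) nu0 => //= r s IHs.
  rewrite inE negb_or eq_sym -lt0n => /andP[r_gt0 /IHs].
  by move=> /(leq_add r_gt0); rewrite add1n.
have le_nu r : r \in val nu -> (r <= d)%N.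
  suff: r \in val nu -> (r <= sumn (val nu))%N by rewrite sum_nu.
  elim: (val nu) => //= q s IHs; rewrite inE.
  move=> /orP[/eqP->|/IHs le_r]; first exact: leq_addr.
  by apply: leq_trans le_r _; apply: leq_addl.
rewrite /yd_decode /yd_code /insub_bseq val_insubd size_map size_nu -map_comp.
rewrite map_id_in ?valK // => r /le_nu le_r.
by rewrite /= inordK.
Qed.

HB.instance Definition _ :=
  Countable.copy (young_diagram d) (pcan_type yd_codeK).
HB.instance Definition _ : isFinite (young_diagram d) := PCanIsFinite yd_codeK.

End YoungFinite.

Definition height d (nu : young_diagram d) : nat := size nu.

Definition double_rows (rows : seq nat) : seq nat :=
  flatten [seq [:: r; r] | r <- rows].

Lemma double_rowsP k (la : young_diagram k) :
  is_young_diagram (2 * k) (double_rows la).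
Proof.
case: la => la /= /and3P[sorted_la la0 /eqP <-]; apply/and3P; split.
- case: la sorted_la {la0} => //= r s; rewrite leqnn /=.
  by elim: s r => //= q s IHs r /andP[-> /IHs]; rewrite leqnn.
- apply: contra la0 => /flatten_mapP[r la_r].
  by rewrite !in_cons in_nil orbF orbb => /eqP->.
- apply/eqP; elim: la {sorted_la la0} => //= r s ->.
  by rewrite addnA addnn -mul2n mulnDr.
Qed.

Definition delta k (la : young_diagram k) : young_diagram (2 * k) :=
  YoungDiagram (double_rowsP la).

Section Specht.
Variables (d : nat) (nu : young_diagram d).

(* The boxes of nu are numbered by 'I_d along successive rows: this is the
   tableau of shape nu that is used for the Young symmetrizer. *)
Definition box_row (i : 'I_d) : nat := reshape_index nu i.
Definition box_col (i : 'I_d) : nat := reshape_offset nu i.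

Definition row_group : {set 'S_d} :=
  [set p : 'S_d | [forall i, box_row (p i) == box_row i]].
Definition col_group : {set 'S_d} :=
  [set q : 'S_d | [forall i, box_col (q i) == box_col i]].

(* c = sum of sgn(q) p o q over p in the row group and q in the column group,
   as a row vector over the basis of Q[S_d] that carries regular_repr.  Products
   of permutations are read from left to right, hence q * p for p o q. *)
Definition young_symmetrizer : 'rV[rat]_#|[set: 'S_d]| :=
  \sum_(p in row_group) \sum_(q in col_group)
    (-1) ^+ q *: delta_mx 0 (gring_index [set: 'S_d]%G (q * p)%g).

(* x acts on Q[S_d] by v |-> v * x, that is v |-> x o v, so this is the left
   ideal Q[S_d] c for the usual composition of permutations.  For nu = [d] it is
   spanned by the sum of all permutations, hence trivial. *)
Definition specht_module : 'M[rat]_#|[set: 'S_d]| :=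
  cyclic_mx (regular_repr rat [set: 'S_d]%G) young_symmetrizer.

Definition specht_repr :
    mx_representation rat [set: 'S_d]%G (\rank specht_module) :=
  submod_repr
    (cyclic_mx_module (regular_repr rat [set: 'S_d]%G) young_symmetrizer).

End Specht.

(* The degree of a representation is the index of its type. *)
Definition repr_dim (F : fieldType) (gT : finGroupType) (G : {group gT}) (n : nat)
  (rG : mx_representation F G n) : nat := n.

(* Main.v *)
(* The symmetric group acts on H^(x)n by orthogonal matrices and commutes with Sp.
   Let V be the space of Sp-invariants and c_nu the Young symmetrizers.

   - A nonzero S_n-stable subspace of an orthogonal representation is not killed by
     all the c_nu: it contains a nonzero vector fixed by the row group of some nu and
     annihilated by the raising operators ("highest weight vector"), and such a vector
     is not killed by the column antisymmetrizer of nu.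
   - A vector v of V c_nu is determined by the polynomial F(M) = <v, M_1 (x) ... >
     in the rows M_1, M_2, ... of a matrix M, each row being repeated along the
     corresponding row of nu.  F is invariant under Sp on the right and multiplied by a
     character under lower triangular matrices on the left.  By symplectic Gram-Schmidt
     the product of these two groups is dense, so F is determined by its value at the
     symplectic basis x_1, y_1, x_2, y_2, ...; hence dim V c_nu <= 1.  Scaling a
     hyperbolic pair by (2, 1/2) shows that V c_nu = 0 unless nu_(2r) = nu_(2r+1) for
     all r (from r = 0) and nu has at most 2g rows, that is, unless nu is some delta la
     with la of height at most g.
   - For nu = delta la, putting one copy of the symplectic form on each vertical domino
     of nu gives an invariant th_la with th_la c_nu <> 0, because the sum over the column
     group that computes it has only nonnegative terms.

   The modules generated by the th_la c_(delta la) are copies of the Specht modules and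
   are independent.  They span V, since the orthogonal complement of their sum in V is
   killed by all the c_nu. *)

Require Import Defs.
From HB Require Import structures.
From mathcomp Require Import all_boot all_order all_algebra all_fingroup.
From mathcomp Require Import mxrepresentation.
From mathcomp.real_closed Require Import mxtens.
From mathcomp.classical Require Import boolp.
From mathcomp Require Import zify ring lra.

Set Implicit Arguments.
Unset Strict Implicit.
Unset Printing Implicit Defensive.

Import Order.TTheory GRing.Theory Num.Theory.

(** * Sums over permutation groups preserving a colouring *)

Section ColourStabiliser.
Local Open Scope group_scope.
Variable n : nat.

(** Row groups, column groups, symmetric groups of subsets and the trivial group all arise from a
    suitable [f], so that their sums are handled at once. *)
Definition colour_stab (T : eqType) (f : 'I_n -> T) : {set 'S_n} :=
  [set s : 'S_n | [forall i, f (s i) == f i]].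

Lemma colour_stabP (T : eqType) (f : 'I_n -> T) (s : 'S_n) :
  reflect (forall i, f (s i) = f i) (s \in colour_stab f).
Proof.
rewrite inE; apply: (iffP forallP) => sf i; first exact/eqP.
by rewrite sf.
Qed.

Lemma colour_stab_group_set (T : eqType) (f : 'I_n -> T) :
  group_set (colour_stab f).
Proof.
apply/group_setP; split=> [|s t].
  by apply/colour_stabP => i; rewrite perm1.
move=> /colour_stabP sf /colour_stabP tf.
by apply/colour_stabP => i; rewrite permM tf sf.
Qed.
Canonical colour_stab_group (T : eqType) (f : 'I_n -> T) :=
  Group (colour_stab_group_set f).

Lemma tperm_colour_stab (T : eqType) (f : 'I_n -> T) i j :
  f i = f j -> tperm i j \in colour_stab f.
Proof. by move=> fij; apply/colour_stabP => k; case: tpermP => // ->. Qed.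

End ColourStabiliser.

(** * Signed sums over colour stabilisers, and the standard inner product *)

Section ColourSums.
Local Open Scope ring_scope.
Variables (n d : nat) (rG : mx_representation rat [set: 'S_n]%G d).

Lemma repr_permM (s t : 'S_n) : rG (s * t)%g = rG s *m rG t.
Proof. by rewrite repr_mxM ?in_setT. Qed.

(** The flag selects the sign character or the trivial one, so that antisymmetrizers and
    symmetrizers share their lemmas. *)
Definition psign (sg : bool) (s : 'S_n) : rat := (-1) ^+ (sg && odd_perm s).

Lemma psignM sg s t : psign sg (s * t)%g = psign sg s * psign sg t.
Proof. by rewrite /psign odd_permM; case: sg; rewrite ?mulr1 // signr_addb. Qed.

Lemma psignV sg s : psign sg s^-1%g = psign sg s.
Proof. by rewrite /psign odd_permV. Qed.

Lemma psign1 sg : psign sg 1%g = 1.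
Proof. by rewrite /psign odd_perm1 andbF. Qed.

Lemma psign_sq sg s : psign sg s * psign sg s = 1.
Proof. by rewrite -{1}psignV -psignM mulVg psign1. Qed.

Lemma psign_sym s : psign false s = 1.
Proof. by []. Qed.

Lemma psign_tperm sg i j : i != j -> psign sg (tperm i j) = (-1) ^+ sg.
Proof. by rewrite /psign odd_tperm => ->; rewrite andbT. Qed.

Definition ysum (sg : bool) (T : eqType) (f : 'I_n -> T) : 'M[rat]_d :=
  \sum_(s in colour_stab f) psign sg s *: rG s.

Variable sg : bool.

Lemma ysum_mulr (T : eqType) (f : 'I_n -> T) s :
  s \in colour_stab f -> ysum sg f *m rG s = psign sg s *: ysum sg f.
Proof.
move=> Gs; rewrite /ysum mulmx_suml scaler_sumr.
rewrite (reindex_inj (mulIg s^-1)%g) /=; apply: eq_big => [t|t Gt].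
  by rewrite groupMr ?groupV.
by rewrite -scalemxAl -repr_permM mulgKV psignM psignV scalerA mulrC.
Qed.

Lemma ysum_mull (T : eqType) (f : 'I_n -> T) s :
  s \in colour_stab f -> rG s *m ysum sg f = psign sg s *: ysum sg f.
Proof.
move=> Gs; rewrite /ysum mulmx_sumr scaler_sumr.
rewrite (reindex_inj (mulgI s^-1)%g) /=; apply: eq_big => [t|t Gt].
  by rewrite groupMl ?groupV.
by rewrite -scalemxAr -repr_permM mulKVg psignM psignV scalerA.
Qed.

Lemma ysum_sq (T : eqType) (f : 'I_n -> T) :
  ysum sg f *m ysum sg f = #|colour_stab f|%:R *: ysum sg f.
Proof.
rewrite {2}/ysum mulmx_sumr (eq_bigr (fun _ => ysum sg f)) => [|s Gs].
  by rewrite sumr_const scaler_nat.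
by rewrite -scalemxAr ysum_mulr // scalerA psign_sq scale1r.
Qed.

(** The transpositions [tperm j i] are coset representatives for the stabiliser of [j]: an element
    sending [j] to [i] is one fixing [j] followed by [tperm j i]. *)
Lemma ysum_coset (T T' : eqType) (f : 'I_n -> T) (f' : 'I_n -> T') j :
  (forall s, (s \in colour_stab f') = (s \in colour_stab f) && (s j == j)) ->
  ysum sg f =
  \sum_(i | f i == f j) psign sg (tperm j i) *: (ysum sg f' *m rG (tperm j i)).
Proof.
move=> stab_f'; rewrite {1}/ysum.
rewrite (partition_big (fun s : 'S_n => s j) (fun i => f i == f j)) /=; last first.
  by move=> s /colour_stabP->.
apply: eq_bigr => i /eqP fi; rewrite /ysum mulmx_suml scaler_sumr.
rewrite (reindex_inj (mulIg (tperm j i))) /=.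
have t_f : tperm j i \in colour_stab f by apply: tperm_colour_stab.
apply: eq_big => [s|s _].
  rewrite stab_f' groupMr // permM; congr (_ && _).
  by rewrite -{2}(tpermL j i) (inj_eq perm_inj).
by rewrite psignM repr_permM -scalemxAl scalerA mulrC.
Qed.

Definition dot d0 (u v : 'rV[rat]_d0) : rat := (u *m v^T) 0 0.

Lemma dotE d0 (u v : 'rV_d0) : dot u v = \sum_i u 0 i * v 0 i.
Proof. by rewrite /dot mxE; apply: eq_bigr => i _; rewrite mxE. Qed.

Lemma dotC d0 (u v : 'rV_d0) : dot u v = dot v u.
Proof. by rewrite !dotE; apply: eq_bigr => i _; rewrite mulrC. Qed.

Lemma dotDl d0 (u v w : 'rV_d0) : dot (u + v) w = dot u w + dot v w.
Proof. by rewrite /dot mulmxDl mxE. Qed.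

Lemma dotZl d0 a (u v : 'rV_d0) : dot (a *: u) v = a * dot u v.
Proof. by rewrite /dot -scalemxAl mxE. Qed.

Lemma dotZr d0 a (u v : 'rV_d0) : dot u (a *: v) = a * dot u v.
Proof. by rewrite dotC dotZl dotC. Qed.

Lemma dot_sumr d0 (I : Type) (r : seq I) (P : pred I) (u : 'rV_d0) F :
  dot u (\sum_(i <- r | P i) F i) = \sum_(i <- r | P i) dot u (F i).
Proof. by rewrite /dot raddf_sum mulmx_sumr summxE. Qed.

Lemma dot_mulmx d0 (u v : 'rV_d0) (M : 'M_d0) : dot (u *m M) v = dot u (v *m M^T).
Proof. by rewrite /dot trmx_mul trmxK mulmxA. Qed.

Lemma dot_ge0 d0 (u : 'rV_d0) : 0 <= dot u u.
Proof. by rewrite dotE sumr_ge0 // => i _; rewrite -expr2 sqr_ge0. Qed.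

Lemma dot_eq0 d0 (u : 'rV_d0) : (dot u u == 0) = (u == 0).
Proof.
apply/idP/eqP => [|->]; last by rewrite /dot mul0mx mxE.
rewrite dotE psumr_eq0 => [/allP u0|i _]; last by rewrite -expr2 sqr_ge0.
apply/rowP => i; rewrite mxE; apply/eqP.
by rewrite -[_ == _]orbb -mulf_eq0; apply: u0; rewrite mem_index_enum.
Qed.

Definition orthogonal_repr := forall s : 'S_n, (rG s)^T = rG s^-1%g.
Hypothesis rG_orth : orthogonal_repr.

Lemma ysum_tr (T : eqType) (f : 'I_n -> T) : (ysum sg f)^T = ysum sg f.
Proof.
rewrite /ysum raddf_sum /= (reindex_inj invg_inj) /=.
apply: eq_big => [s|s _]; first by rewrite groupV.
by rewrite linearZ /= rG_orth invgK psignV.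
Qed.

(** Up to the order of the group, [ysum] is a symmetric idempotent, that is, an orthogonal
    projection. *)
Lemma dot_ysum (T : eqType) (f : 'I_n -> T) u v :
  #|colour_stab f|%:R * dot (u *m ysum sg f) v =
  dot (u *m ysum sg f) (v *m ysum sg f).
Proof. by rewrite -{3}ysum_tr -dot_mulmx -mulmxA ysum_sq -scalemxAr dotZl. Qed.

Lemma card_colour_stab_gt0 (T : eqType) (f : 'I_n -> T) :
  (0 : rat) < #|colour_stab f|%:R.
Proof. by rewrite ltr0n cardG_gt0. Qed.

Lemma dot_ysum_ge0 (T : eqType) (f : 'I_n -> T) u : 0 <= dot (u *m ysum sg f) u.
Proof.
by rewrite -(pmulr_rge0 _ (card_colour_stab_gt0 f)) dot_ysum dot_ge0.
Qed.

End ColourSums.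

(** * Boxes of a Young diagram *)

Section Boxes.
Variables (n : nat) (nu : young_diagram n).

Lemma sumn_diagram : sumn nu = n.
Proof. by have /and3P[_ _ /eqP] := valP nu. Qed.

Lemma nth_diagram_leq r r' : (r <= r')%N -> (nth 0 nu r' <= nth 0 nu r)%N.
Proof.
move=> le_rr'; case: (ltnP r' (size nu)) => [lt_r'|?]; last by rewrite nth_default.
have /and3P[nu_sorted _ _] := valP nu.
apply: (sorted_leq_nth _ _ 0 nu_sorted) => //.
- by move=> a b c /= ba cb; apply: leq_trans cb ba.
- by move=> a /=; apply: leqnn.
- exact: leq_ltn_trans le_rr' lt_r'.
Qed.

Lemma nth_diagram_gt0 r : (0 < nth 0 nu r)%N = (r < size nu)%N.
Proof.
case: (ltnP r (size nu)) => [lt_r|?]; last by rewrite nth_default.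
have /and3P[_ nu0 _] := valP nu; rewrite lt0n; apply: contraNneq nu0 => <-.
exact: mem_nth.
Qed.

Lemma box_col_lt (p : 'I_n) : (box_col nu p < nth 0 nu (box_row nu p))%N.
Proof. by apply: reshape_offsetP; rewrite sumn_diagram. Qed.

Lemma box_inj (p q : 'I_n) :
  box_row nu p = box_row nu q -> box_col nu p = box_col nu q -> p = q.
Proof.
rewrite /box_row /box_col => eq_r eq_c; apply: val_inj => /=.
by rewrite -(reshape_indexK nu p) eq_r eq_c reshape_indexK.
Qed.

Lemma box_ex r c : (c < nth 0 nu r)%N ->
  exists p : 'I_n, box_row nu p = r /\ box_col nu p = c.
Proof.
move=> lt_c; have := flatten_indexP lt_c; rewrite sumn_diagram => lt_n.
exists (Ordinal lt_n); rewrite /box_row /box_col /=.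
by rewrite flatten_indexKl ?flatten_indexKr.
Qed.

Lemma box_row_leq (p q : 'I_n) : (p <= q)%N -> (box_row nu p <= box_row nu q)%N.
Proof.
by rewrite (reshape_leq nu) => /orP[/ltnW|/andP[/eqP]]; rewrite /box_row // => ->.
Qed.

Lemma box_above (p : 'I_n) r : (r <= box_row nu p)%N ->
  exists q : 'I_n, box_row nu q = r /\ box_col nu q = box_col nu p.
Proof.
move=> le_r; apply: box_ex; apply: leq_trans (box_col_lt p) _.
exact: nth_diagram_leq.
Qed.

Lemma card_box_row r : #|[pred p : 'I_n | box_row nu p == r]| = nth 0 nu r.
Proof.
have lt_n (c : 'I_(nth 0 nu r)) : (flatten_index nu r c < n)%N.
  by have := flatten_indexP (ltn_ord c); rewrite sumn_diagram.
pose box c : 'I_n := Ordinal (lt_n c).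
have box_row_box c : box_row nu (box c) = r by rewrite /box_row flatten_indexKl.
have box_col_box c : box_col nu (box c) = c by rewrite /box_col flatten_indexKr.
have inj_box : injective box.
  by move=> c c' eq_box; apply: val_inj; rewrite /= -!box_col_box eq_box.
rewrite -[RHS]card_ord -(card_codom inj_box); apply: eq_card => p.
rewrite inE; apply/eqP/codomP => [row_p|[c ->] //].
have lt_c : (box_col nu p < nth 0 nu r)%N by rewrite -row_p box_col_lt.
exists (Ordinal lt_c); apply: box_inj; rewrite ?box_row_box ?row_p //.
Qed.

(* The box of p is moved to the row numbered by the rank of f p among the values
   of f on the column of p; this rank is at most f p. *)
Lemma column_injective_sum (f : 'I_n -> nat) :
    (forall p q, box_col nu p = box_col nu q -> f p = f q -> p = q) ->
  (\sum_p box_row nu p <= \sum_p f p)%N /\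
  (\sum_p box_row nu p = \sum_p f p ->
   exists2 q, q \in colour_stab (box_col nu) & forall p, f (q p) = box_row nu p)%N.
Proof.
move=> f_inj.
pose below p := [pred q | (box_col nu q == box_col nu p) && (f q < f p)%N].
pose g p := #|below p|.
have g_le p : (g p <= f p)%N.
  have inj_f : {in below p &, injective f}.
    by move=> q q' /andP[/eqP cq _] /andP[/eqP cq' _]; apply: f_inj; rewrite cq cq'.
  rewrite /g cardE -(size_map f) -(size_iota 0 (f p)); apply: uniq_leq_size.
    rewrite map_inj_in_uniq ?enum_uniq // => q q'.
    by rewrite !mem_enum; apply: inj_f.
  by move=> _ /mapP[q + ->]; rewrite mem_enum mem_iota => /andP[].
have below_col p : (g p < #|[pred q | box_col nu q == box_col nu p]|)%N.
  apply: proper_card; apply/properP; split.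
    by apply/subsetP => q /andP[].
  by exists p; rewrite !inE ?eqxx // ltnn.
(* There is a box in row [g p] of the column of [p]: otherwise the whole column would lie in the
   first [g p] rows, but it has more than [g p] boxes. *)
have g_lt p : (box_col nu p < nth 0 nu (g p))%N.
  rewrite ltnNge; apply: contraL (below_col p) => le_c; rewrite -leqNgt.
  rewrite cardE -(size_map (box_row nu)) -(size_iota 0 (g p)).
  apply: uniq_leq_size => [|_ /mapP[q + ->]].
    rewrite map_inj_in_uniq ?enum_uniq // => q q'.
    rewrite !mem_enum => /eqP cq /eqP cq' /box_inj; apply; exact: etrans (esym cq').
  rewrite mem_enum mem_iota /= add0n => /eqP cq.
  rewrite ltnNge; apply/negP => /nth_diagram_leq/leq_trans/(_ le_c).
  by rewrite leqNgt -cq box_col_lt.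
have g_mono p p' : box_col nu p = box_col nu p' -> (f p < f p')%N -> (g p < g p')%N.
  move=> cp lt_f; apply: proper_card; apply/properP; split.
    apply/subsetP => q /andP[/eqP cq lt_q].
    by rewrite inE cq cp eqxx (ltn_trans lt_q).
  by exists p; rewrite !inE ?cp ?eqxx // ltnn.
have box_g p : exists q, (box_row nu q == g p) && (box_col nu q == box_col nu p).
  by have [q [rq cq]] := box_ex (g_lt p); exists q; rewrite rq cq !eqxx.
pose mv p := xchoose (box_g p).
have row_mv p : box_row nu (mv p) = g p by have /andP[/eqP] := xchooseP (box_g p).
have col_mv p : box_col nu (mv p) = box_col nu p.
  by have /andP[_ /eqP] := xchooseP (box_g p).
have mv_inj : injective mv.
  move=> p p' eq_mv; have cp : box_col nu p = box_col nu p'.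
    by rewrite -(col_mv p) eq_mv col_mv.
  have gp : g p = g p' by rewrite -(row_mv p) eq_mv row_mv.
  apply: f_inj => //; apply/eqP; rewrite eqn_leq (leqNgt (f p)) (leqNgt (f p')); apply/andP.
  by split; apply/negP => /g_mono; rewrite cp gp ltnn => /(_ erefl).
have sum_g : (\sum_p box_row nu p = \sum_p g p)%N.
  by rewrite (reindex_inj mv_inj) /=; apply: eq_bigr => p _; rewrite row_mv.
split=> [|sum_f]; first by rewrite sum_g leq_sum.
have g_f p : g p = f p.
  have : (\sum_p g p == \sum_p f p)%N by rewrite -sum_g sum_f.
  rewrite (leqif_sum (fun p _ => leqif_eq (g_le p))).2 => /forallP/(_ p)/eqP.
  exact.
exists (perm mv_inj)^-1%g; last first.
  by move=> p; rewrite -g_f -row_mv -{1}(permE mv_inj) permKV.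
rewrite groupV; apply/colour_stabP => p; rewrite permE; exact: col_mv.
Qed.

End Boxes.

(** * Young symmetrizers *)

Section Symmetrizers.
Local Open Scope ring_scope.
Variable n : nat.
Implicit Types (nu mu : young_diagram n) (s : 'S_n).

Local Notation repr d := (mx_representation rat [set: 'S_n]%G d).

Definition ycol d (rG : repr d) nu : 'M_d := ysum rG true (box_col nu).
Definition yrow d (rG : repr d) nu : 'M_d := ysum rG false (box_row nu).
(** Row vectors meet the column sum first, which matches the products [q * p] in
    [young_symmetrizer]. *)
Definition ysym d (rG : repr d) nu : 'M_d := ycol rG nu *m yrow rG nu.

Lemma ycol_mulr d (rG : repr d) nu s : s \in colour_stab (box_col nu) ->
  ycol rG nu *m rG s = (-1) ^+ s *: ycol rG nu.
Proof. exact: ysum_mulr. Qed.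

Lemma yrow_mull d (rG : repr d) nu s : s \in colour_stab (box_row nu) ->
  rG s *m yrow rG nu = yrow rG nu.
Proof. by move=> Rs; rewrite ysum_mull // scale1r. Qed.

(* A pair of boxes in one column that s sends to one row makes the product equal
   to its opposite. *)
Lemma ycol_yrow_neq0 nu mu s d (rG : repr d) :
    ycol rG mu *m rG s *m yrow rG nu != 0 ->
  forall p q, box_col mu p = box_col mu q ->
    box_row nu (s p) = box_row nu (s q) -> p = q.
Proof.
move=> nz p q cpq rpq; apply/eqP; apply: contraR nz => neq_pq.
have eq_t : (tperm p q * s = s * tperm (s p) (s q))%g.
  by rewrite -tpermJ /conjg !mulgA mulgV mul1g.
have := ycol_mulr rG (tperm_colour_stab cpq).
move=> /(congr1 (fun M => M *m rG s *m yrow rG nu)) /=.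
rewrite -(mulmxA (ycol _ _) (rG (tperm _ _))) -repr_permM eq_t repr_permM !mulmxA.
rewrite -(mulmxA _ (rG (tperm _ _)) (yrow _ _)) yrow_mull ?tperm_colour_stab //.
rewrite odd_tperm neq_pq expr1 scaleN1r !mulNmx => /eqP.
by rewrite -addr_eq0 -mulr2n -scaler_nat scaler_eq0.
Qed.

Definition row_separates nu mu s := [forall p, forall q,
  (box_col mu p == box_col mu q) ==>
  (box_row nu (s p) == box_row nu (s q)) ==> (p == q)].

Lemma row_separatesP nu mu s :
  reflect (forall p q, box_col mu p = box_col mu q ->
             box_row nu (s p) = box_row nu (s q) -> p = q)
          (row_separates nu mu s).
Proof.
apply: (iffP forallP) => inj_s p.
  move=> q /eqP cpq /eqP rpq; apply/eqP.
  by move: (inj_s p) => /forallP/(_ q); rewrite cpq rpq.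
apply/forallP => q; apply/implyP => /eqP cpq.
by apply/implyP => /eqP rpq; apply/eqP; apply: inj_s.
Qed.

(** The total of the row numbers replaces the dominance order: separation compares the totals, and
    equality lets a column permutation of [mu] carry [s] to a map matching rows with rows. *)
Lemma row_separates_sum nu mu s : row_separates nu mu s ->
  (\sum_p box_row mu p <= \sum_p box_row nu p)%N /\
  (\sum_p box_row mu p = \sum_p box_row nu p ->
   exists2 q, q \in colour_stab (box_col mu) &
              forall p, box_row nu (s (q p)) = box_row mu p)%N.
Proof.
move=> /row_separatesP inj_s.
have sum_s : (\sum_p box_row nu (s p) = \sum_p box_row nu p)%N.
  by rewrite [RHS](reindex_inj (@perm_inj _ s)).
by have := column_injective_sum inj_s; rewrite sum_s.
Qed.

(** If [s] separates, the totals agree trivially and [s] is a column permutation times a row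
    permutation, which leaves a sign; otherwise the product is zero. The scalar does not depend on
    the representation, which later allows relations to be transferred between representations. *)
Lemma ycol_yrow_same nu s :
  exists e : rat, forall d (rG : repr d),
    ycol rG nu *m rG s *m yrow rG nu = e *: ysym rG nu.
Proof.
have [/row_separates_sum[_ /(_ erefl)[q Cq row_sq]]|] :=
    boolP (row_separates nu nu s).
  exists ((-1) ^+ q) => d rG; rewrite /ysym.
  have Rqs : (q * s)%g \in colour_stab (box_row nu).
    by apply/colour_stabP => p; rewrite permM row_sq.
  rewrite -{2}(yrow_mull rG Rqs) repr_permM !mulmxA (ycol_mulr rG Cq).
  by rewrite -!scalemxAl scalerA -expr2 sqrr_sign scale1r.
move=> not_sep; exists 0 => d rG; rewrite scale0r; apply/eqP.
by apply: contraR not_sep => /ycol_yrow_neq0 inj_s; apply/row_separatesP.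
Qed.

Lemma eq_diagram nu mu :
  (forall r, nth 0%N nu r = nth 0%N mu r) -> nu = mu.
Proof.
move=> eq_nth; apply: val_inj => /=; apply: (@eq_from_nth _ 0%N) => [|r _] //.
apply/eqP; rewrite eqn_leq (leqNgt (size nu)) (leqNgt (size mu)).
by rewrite -!nth_diagram_gt0 eq_nth -(eq_nth (size nu)) !nth_diagram_gt0 !ltnn.
Qed.

Lemma eq_diagram_row nu mu s :
  (forall p, box_row nu (s p) = box_row mu p) -> nu = mu.
Proof.
move=> row_s; apply: eq_diagram => r; rewrite -!card_box_row -!sum1_card.
by rewrite (reindex_inj (@perm_inj _ s)); apply: eq_bigl => p; rewrite !inE row_s.
Qed.

(** If separating permutations existed in both directions, the two totals would agree and the
    equality case would identify the diagrams. *)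
Lemma ycol_yrow_distinct nu mu : nu != mu ->
  (forall s d (rG : repr d), ycol rG mu *m rG s *m yrow rG nu = 0) \/
  (forall s d (rG : repr d), ycol rG nu *m rG s *m yrow rG mu = 0).
Proof.
move=> neq_numu.
have not_sep nu1 mu1 : ~~ [exists s, row_separates nu1 mu1 s] ->
    forall s d (rG : repr d), ycol rG mu1 *m rG s *m yrow rG nu1 = 0.
  move=> no_s s d rG; apply/eqP; apply: contraR no_s => /ycol_yrow_neq0 inj_s.
  by apply/existsP; exists s; apply/row_separatesP.
have [/existsP[s /row_separates_sum[le_munu eq_munu]]|/not_sep] :=
    boolP [exists s, row_separates nu mu s]; last by left.
have [/existsP[t /row_separates_sum[le_numu _]]|/not_sep] :=
    boolP [exists t, row_separates mu nu t]; last by right.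
have [|q _ row_sq] := eq_munu; first by apply/eqP; rewrite eqn_leq le_munu.
case/eqP: neq_numu; apply: (@eq_diagram_row nu mu (q * s)%g) => p.
by rewrite permM row_sq.
Qed.

Lemma ysum_sandwich d (rG : repr d) sg sg' (T T' : eqType)
    (f : 'I_n -> T) (f' : 'I_n -> T') s (M N : 'M_d) :
  M *m (ysum rG sg f *m rG s *m ysum rG sg' f') *m N =
  \sum_(p in colour_stab f) \sum_(q in colour_stab f')
     (psign sg p * psign sg' q) *: (M *m rG (p * s * q)%g *m N).
Proof.
rewrite {1}/ysum !mulmx_suml mulmx_sumr mulmx_suml; apply: eq_bigr => p _.
rewrite /ysum mulmx_sumr mulmx_sumr mulmx_suml; apply: eq_bigr => q _.
by rewrite !repr_permM -!(scalemxAl, scalemxAr) !scalerA.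
Qed.

(** In one alternative the outer factors annihilate each other; in the other the inner factor
    vanishes, since its transpose is of the vanishing form. *)
Lemma ysym_ysym_distinct nu mu s d (rG : repr d) : orthogonal_repr rG ->
  nu != mu -> ysym rG mu *m rG s *m ysym rG nu = 0.
Proof.
move=> rG_orth neq_numu.
have -> : ysym rG mu *m rG s *m ysym rG nu =
    ycol rG mu *m (yrow rG mu *m rG s *m ycol rG nu) *m yrow rG nu.
  by rewrite /ysym !mulmxA.
have [zero|zero] := ycol_yrow_distinct neq_numu.
  rewrite ysum_sandwich big1 // => p _; rewrite big1 // => q _.
  by rewrite zero scaler0.
suff -> : yrow rG mu *m rG s *m ycol rG nu = 0 by rewrite mulmx0 mul0mx.
apply: trmx_inj; rewrite !trmx_mul (ysum_tr _ rG_orth) (ysum_tr _ rG_orth).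
by rewrite rG_orth mulmxA zero trmx0.
Qed.

Lemma ysym_quasi_idem nu s : exists e : rat, forall d (rG : repr d),
  ysym rG nu *m rG s *m ysym rG nu = e *: ysym rG nu.
Proof.
have [e eP] := fin_all_exists (ycol_yrow_same nu).
exists (\sum_(p in colour_stab (box_row nu)) \sum_(q in colour_stab (box_col nu))
     (psign false p * psign true q) * e (p * s * q)%g) => d rG.
have -> : ysym rG nu *m rG s *m ysym rG nu =
    ycol rG nu *m (yrow rG nu *m rG s *m ycol rG nu) *m yrow rG nu.
  by rewrite /ysym !mulmxA.
rewrite ysum_sandwich scaler_suml; apply: eq_bigr => p _.
by rewrite scaler_suml; apply: eq_bigr => q _; rewrite eP scalerA.
Qed.

Definition group_alg_mx d (rG : repr d) (y : 'rV[rat]_#|[set: 'S_n]|) : 'M_d :=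
  \sum_i y 0 i *: rG (enum_val i).

(* If N is the right module generated by w C y and N C = N B A = 0, then N A B = 0
   because |x A B|^2 is a multiple of <x A B A, x>, and
   |w C y|^2 = <w, w C y y^T A B> = 0. *)
Lemma ysym_faithful d (rG : repr d) nu (w : 'rV_d) y : orthogonal_repr rG ->
    (forall s, w *m ysym rG nu *m group_alg_mx rG y *m rG s *m ysym rG nu = 0) ->
  w *m ysym rG nu *m group_alg_mx rG y = 0.
Proof.
move=> rG_orth; set u := _ *m group_alg_mx _ _ => uC0.
have uAB0 s : u *m rG s *m yrow rG nu *m ycol rG nu = 0.
  apply/eqP; rewrite -dot_eq0 -dot_ysum // dotC dot_mulmx ysum_tr //.
  rewrite -(mulmxA _ (ycol _ _)) -/(ysym _ _) /yrow /ysum mulmx_sumr mulmx_suml.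
  rewrite big1 => [|p _]; first by rewrite /dot trmx0 mulmx0 mxE mulr0.
  by rewrite -scalemxAr -scalemxAl -(mulmxA u) -repr_permM uC0 scaler0.
apply/eqP; rewrite -dot_eq0 {1}/u -mulmxA dot_mulmx trmx_mul trmx_mul !ysum_tr //.
rewrite /group_alg_mx raddf_sum /= mulmx_suml mulmx_sumr big1 => [|i _].
  by rewrite /dot trmx0 mulmx0 mxE.
by rewrite linearZ /= rG_orth -scalemxAl -scalemxAr !mulmxA uAB0 scaler0.
Qed.

(** Its row space is the cyclic module of [u], and its left kernel is the annihilator of [u] in the
    group algebra, so kernels for different representations are comparable. *)
Definition orbit_mx d (rG : repr d) (u : 'rV_d) : 'M_(#|[set: 'S_n]|, d) :=
  \matrix_i (u *m rG (enum_val i)).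

Lemma mul_orbit_mx d (rG : repr d) u y : y *m orbit_mx rG u = u *m group_alg_mx rG y.
Proof.
rewrite mulmx_sum_row /group_alg_mx mulmx_sumr; apply: eq_bigr => i _.
by rewrite rowK -scalemxAr.
Qed.

Lemma cyclic_orbit_mx d (rG : repr d) u : (cyclic_mx rG u :=: orbit_mx rG u)%MS.
Proof.
apply/eqmxP/andP; split.
  apply/row_subP => i.
  have [A /envelop_mxP[a ->] ->] := cyclic_mxP (row_sub i (cyclic_mx rG u)).
  rewrite mulmx_sumr summx_sub // => s _; rewrite -scalemxAr scalemx_sub //.
  have <- : row (enum_rank_in (in_setT s) s) (orbit_mx rG u) = u *m rG s.
    by rewrite rowK enum_rankK_in ?in_setT.
  exact: row_sub.
apply/row_subP => i; rewrite rowK; apply/cyclic_mxP.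
by exists (rG (enum_val i)) => //; rewrite envelop_mx_id ?in_setT.
Qed.

Lemma ysym_quasi_idem_alg nu y s : exists e : rat, forall d (rG : repr d),
  ysym rG nu *m group_alg_mx rG y *m rG s *m ysym rG nu = e *: ysym rG nu.
Proof.
have [e eP] := fin_all_exists (ysym_quasi_idem nu).
exists (\sum_i y 0 i * e (enum_val i * s)%g) => d rG.
rewrite /group_alg_mx mulmx_sumr !mulmx_suml scaler_suml; apply: eq_bigr => i _.
by rewrite -scalemxAr -!scalemxAl -(mulmxA (ysym _ _)) -repr_permM eP scalerA.
Qed.

(** Writing c for the symmetrizer, c y s c = e c with the same e in both representations. If y kills
    w c, then e = 0 for every s, and [ysym_faithful] shows that y kills w' c. Inclusion of
    annihilators gives the inequality of ranks. *)
Lemma rank_cyclic_ysym_leq nu d d' (rG : repr d) (rG' : repr d') w w' :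
    orthogonal_repr rG' -> w *m ysym rG nu != 0 ->
  (\rank (cyclic_mx rG' (w' *m ysym rG' nu))
     <= \rank (cyclic_mx rG (w *m ysym rG nu)))%N.
Proof.
move=> rG'_orth nz_w; rewrite !cyclic_orbit_mx.
suff /mxrankS : (kermx (orbit_mx rG (w *m ysym rG nu)) <=
    kermx (orbit_mx rG' (w' *m ysym rG' nu)))%MS.
  by rewrite !mxrank_ker leq_sub2lE ?rank_leq_row.
apply/row_subP => i; apply/sub_kermxP; set y := row i _.
have : y *m orbit_mx rG (w *m ysym rG nu) = 0.
  by apply/sub_kermxP; apply: row_sub.
rewrite !mul_orbit_mx => wy0; apply: ysym_faithful => // s.
have [e eP] := ysym_quasi_idem_alg nu y s.
rewrite -3!(mulmxA w') eP.
have /eqP : w *m (ysym rG nu *m group_alg_mx rG y *m rG s *m ysym rG nu) = 0.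
  by rewrite 3!(mulmxA w) wy0 !mul0mx.
by rewrite eP -scalemxAr scaler_eq0 (negPf nz_w) orbF => /eqP->; rewrite scale0r mulmx0.
Qed.

Lemma rank_cyclic_ysym nu d d' (rG : repr d) (rG' : repr d') w w' :
    orthogonal_repr rG -> orthogonal_repr rG' ->
    w *m ysym rG nu != 0 -> w' *m ysym rG' nu != 0 ->
  \rank (cyclic_mx rG (w *m ysym rG nu)) = \rank (cyclic_mx rG' (w' *m ysym rG' nu)).
Proof. by move=> *; apply/eqP; rewrite eqn_leq !rank_cyclic_ysym_leq. Qed.

(** A vector common to the module of [i] and the sum of the others has all its translates killed by
    the symmetrizer of [nu i], as distinct symmetrizers annihilate each other; it is zero by
    [ysym_faithful]. *)
Lemma mxdirect_cyclic_ysym d (rG : repr d) (I : finType) (P : pred I)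
    (nu : I -> young_diagram n) (w : I -> 'rV_d) :
    orthogonal_repr rG -> injective nu ->
  mxdirect (\sum_(i | P i) cyclic_mx rG (w i *m ysym rG (nu i))).
Proof.
move=> rG_orth nu_inj; apply/mxdirect_sumsP => i Pi; apply/eqP.
rewrite -submx0; apply/row_subP => k.
have := row_sub k (cyclic_mx rG (w i *m ysym rG (nu i)) :&:
  \sum_(j | P j && (j != i)) cyclic_mx rG (w j *m ysym rG (nu j)))%MS.
set v := row k _; rewrite sub_capmx cyclic_orbit_mx => /andP[/submxP[y v_y]].
move=> /sub_sumsmxP[z v_z]; rewrite v_y mul_orbit_mx ysym_faithful ?sub0mx // => s.
rewrite -mul_orbit_mx -v_y v_z !mulmx_suml big1 // => j /andP[_ neq_ji].
have /submxP[x ->] : (z j *m cyclic_mx rG (w j *m ysym rG (nu j)) <=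
    orbit_mx rG (w j *m ysym rG (nu j)))%MS.
  by rewrite -cyclic_orbit_mx submxMl.
rewrite mul_orbit_mx /group_alg_mx mulmx_sumr !mulmx_suml big1 // => l _.
rewrite -scalemxAr -!scalemxAl -(mulmxA (w j *m _)) -repr_permM -2!(mulmxA (w j)).
rewrite ysym_ysym_distinct ?mulmx0 ?scaler0 //.
by rewrite (inj_eq nu_inj) eq_sym.
Qed.

End Symmetrizers.

(** * Specht modules compared with cyclic modules in orthogonal representations *)

Section SpechtRank.
Local Open Scope ring_scope.
Variables (n : nat) (nu : young_diagram n).

Local Notation G := [set: 'S_n]%G.
Local Notation reg := (regular_repr rat G).

Lemma regular_reprE s i j :
  reg s i j = (enum_val j == enum_val i * s)%g%:R.
Proof.
rewrite /= /regular_mx !mxE eqxx /=; congr (nat_of_bool _)%:R.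
by rewrite -(inj_eq enum_val_inj) gring_indexK ?in_setT.
Qed.

Lemma regular_repr_orthogonal : orthogonal_repr reg.
Proof.
move=> s; apply/matrixP => i j; rewrite mxE !regular_reprE.
congr (nat_of_bool _)%:R.
by rewrite eq_sym (can2_eq (mulgK s) (mulgKV s)).
Qed.

Lemma young_symmetrizerE :
  young_symmetrizer nu = delta_mx 0 (gring_index G 1%g) *m ysym reg nu.
Proof.
rewrite /young_symmetrizer /ysym /ycol /ysum mulmxA !mulmx_sumr.
apply: eq_bigr => p _; rewrite mulmx_suml psign_sym scale1r.
apply: eq_bigr => q _; rewrite -!(scalemxAr, scalemxAl).
congr (_ *: _); rewrite -mulmxA -repr_permM -rowE.
apply/rowP => j; rewrite [RHS]mxE regular_reprE gring_indexK ?group1 // mul1g.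
rewrite mxE eqxx /= -(inj_eq enum_val_inj) gring_indexK ?in_setT //.
Qed.

(** The coefficient of the identity is 1, because the row group and the column group meet
    trivially. *)
Lemma young_symmetrizer_neq0 : young_symmetrizer nu != 0.
Proof.
apply/eqP => /rowP/(_ (gring_index G 1%g))/eqP; rewrite [in X in _ == X]mxE.
have coef (p q : 'S_n) : (delta_mx 0 (gring_index G (q * p)%g) : 'rV[rat]_#|G|) 0
    (gring_index G 1%g) = (q * p == 1)%g%:R.
  rewrite mxE /=; congr (nat_of_bool _)%:R.
  by rewrite -(inj_eq enum_val_inj) !gring_indexK ?in_setT // eq_sym.
have R1 : 1%g \in row_group nu := group1 (colour_stab_group (box_row nu)).
have C1 : 1%g \in col_group nu := group1 (colour_stab_group (box_col nu)).
rewrite /young_symmetrizer summxE (bigD1 1%g) //=.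
rewrite summxE (bigD1 1%g) //= mxE coef mulg1 eqxx odd_perm1 mulr1.
rewrite big1 => [|q /andP[_ q1]]; last by rewrite mxE coef mulg1 (negPf q1) mulr0.
rewrite addr0 big1 ?addr0 ?oner_eq0 // => p /andP[Rp p1].
rewrite summxE big1 // => q Cq; rewrite mxE coef.
have [qp1|] := eqVneq (q * p)%g 1%g; last by rewrite mulr0.
case/eqP: p1; apply/permP => i; rewrite perm1; apply: (@box_inj _ nu).
  exact: (colour_stabP _ _ Rp).
have /colour_stabP/(_ i) <- : q^-1%g \in colour_stab (box_col nu).
  by rewrite groupV.
by rewrite -(mulKg q p) qp1 mulg1.
Qed.

Lemma rank_specht_module d (rG : mx_representation rat G d) w :
    orthogonal_repr rG -> w *m ysym rG nu != 0 ->
  \rank (specht_module nu) = \rank (cyclic_mx rG (w *m ysym rG nu)).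
Proof.
move=> rG_orth nz_w; rewrite /specht_module young_symmetrizerE.
apply: rank_cyclic_ysym => //; first exact: regular_repr_orthogonal.
by rewrite -young_symmetrizerE young_symmetrizer_neq0.
Qed.

End SpechtRank.

(** * Completeness of the Young symmetrizers *)

Section DiagramOfColouring.
Variable n : nat.

Lemma diagram_of_colouring (f : 'I_n -> nat) :
    (forall r s, r < s -> #|[pred p | f p == s]| <= #|[pred p | f p == r]|)%N ->
  exists (nu : young_diagram n) (s : 'S_n), forall p, f (s p) = box_row nu p.
Proof.
move=> m_dec; pose m r := #|[pred p | f p == r]|.
have m_out r : (forall p, (f p < r)%N) -> m r == 0%N.
  move=> f_lt; apply/eqP; apply: eq_card0 => p; rewrite !inE.
  by apply/negP => /eqP fp; have := f_lt p; rewrite fp ltnn.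
have ex_out : exists h, m h == 0%N.
  exists (\max_p f p).+1; apply: m_out => p; rewrite ltnS; exact: leq_bigmax.
case: (ex_minnP ex_out) => h mh0 h_min.
have m_pos r : (r < h)%N -> (0 < m r)%N.
  by move=> lt_r; rewrite lt0n; apply: contraTneq lt_r => mr0; rewrite -leqNgt h_min ?mr0.
have m_zero r : (h <= r)%N -> m r = 0%N.
  rewrite leq_eqVlt => /predU1P[<-|/m_dec]; first exact/eqP.
  by rewrite -/(m r) -/(m h) (eqP mh0) leqn0 => /eqP.
have f_lt p : (f p < h)%N.
  rewrite ltnNge; apply/negP => /m_zero/card0_eq/(_ p); by rewrite !inE eqxx.
have nu_diagram : is_young_diagram n (mkseq m h).
  apply/and3P; split.
  - apply/(sortedP 0%N) => r; rewrite size_mkseq => lt_r.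
    by rewrite !nth_mkseq ?(ltnW lt_r) //; apply: m_dec.
  - apply/mapP => -[r]; rewrite mem_iota => /andP[_ /m_pos].
    by move=> + m0; rewrite -m0.
  - rewrite sumnE big_map -[X in _ == X]card_ord -sum1_card.
    rewrite -[h in iota 0 h]subn0 -/(index_iota 0 h) big_mkord.
    rewrite (partition_big (fun p => Ordinal (f_lt p)) predT) //=.
    by apply/eqP; apply: eq_bigr => r _; rewrite /m -sum1_card; apply: eq_bigl.
pose nu : young_diagram n := YoungDiagram nu_diagram.
have card_nu r : #|[pred p | box_row nu p == r]| = m r.
  rewrite card_box_row /=; case: (ltnP r h) => [lt_r|le_r].
    by rewrite nth_mkseq.
  by rewrite nth_default ?size_mkseq // m_zero.
have /tuple_permP[s eq_s] :
    perm_eq [tuple box_row nu p | p < n] [tuple f p | p < n].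
  have count_val (e : 'I_n -> nat) r :
      count_mem r [tuple e p | p < n] = #|[pred p | e p == r]|.
    by rewrite count_map val_ord_tuple cardE [in RHS]/enum_mem size_filter enumT.
  by apply/allP => r _; rewrite /= !count_val card_nu.
exists nu, s => p.
have := congr1 (fun t : seq nat => nth 0%N t p) eq_s.
by rewrite -!tnth_nth !tnth_mktuple.
Qed.

End DiagramOfColouring.

(** * Vectors fixed by a colour stabiliser *)

Section FixedVectors.
Local Open Scope ring_scope.
Variables (n d : nat) (rG : mx_representation rat [set: 'S_n]%G d).

Definition fixed_by (T : eqType) (f : 'I_n -> T) (x : 'rV_d) :=
  forall s, s \in colour_stab f -> x *m rG s = x.

Lemma fixed_by_ysum (T : eqType) (f : 'I_n -> T) x :
  fixed_by f x -> x *m ysum rG false f = #|colour_stab f|%:R *: x.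
Proof.
move=> x_fix; rewrite /ysum mulmx_sumr (eq_bigr (fun _ => x)) => [|s /x_fix].
  by rewrite sumr_const scaler_nat.
by rewrite psign_sym scale1r.
Qed.

Lemma ysum_fixed_by (T : eqType) (f : 'I_n -> T) x :
  fixed_by f (x *m ysum rG false f).
Proof. by move=> s fs; rewrite -mulmxA ysum_mulr // psign_sym scale1r. Qed.

Lemma fixed_by_coset (T T' : eqType) (f : 'I_n -> T) (f' : 'I_n -> T') j x :
    (forall s, (s \in colour_stab f') = (s \in colour_stab f) && (s j == j)) ->
    fixed_by f' x ->
  x *m ysum rG false f =
  #|colour_stab f'|%:R *: \sum_(i | f i == f j) x *m rG (tperm j i).
Proof.
move=> stab_f' /fixed_by_ysum x_fix; rewrite (ysum_coset _ _ stab_f') mulmx_sumr.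
rewrite scaler_sumr; apply: eq_bigr => i _.
by rewrite psign_sym scale1r mulmxA x_fix scalemxAl.
Qed.

(** Merging [Y] into the colour [None] and keeping the other points apart makes the stabiliser the
    symmetric group of [Y]; here it is found inside that of [Y] with [j] adjoined. *)
Lemma stab_one_more (Y : pred 'I_n) j s : ~~ Y j ->
  (s \in colour_stab (fun p => if Y p then None else Some p)) =
  (s \in colour_stab (fun p => if Y p || (p == j) then None else Some p))
    && (s j == j).
Proof.
move=> Yj; apply/colour_stabP/andP => [s_f|[/colour_stabP s_f /eqP sj] p].
  have sj : s j = j by have := s_f j; rewrite (negPf Yj); case: ifP => // _ [].
  split; last exact/eqP; apply/colour_stabP => p.
  have [->|neq_pj] := eqVneq p j; first by rewrite sj eqxx orbT.
  have : s p != j by rewrite -{1}sj (inj_eq perm_inj).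
  by move=> /negPf sp; rewrite sp !orbF; apply: s_f.
have [->|neq_pj] := eqVneq p j; first by rewrite sj.
have : s p != j by rewrite -{1}sj (inj_eq perm_inj).
by move=> /negPf sp; have := s_f p; rewrite (negPf neq_pj) sp !orbF.
Qed.

(* 1 + sum_(i in Y) (j i) is a positive multiple of an orthogonal projection on
   the vectors that are fixed by Sym(Y). *)
Lemma dot_tperm_sum_ge (Y : pred 'I_n) j x : orthogonal_repr rG -> ~~ Y j ->
    fixed_by (fun p => if Y p then None else Some p) x ->
  - dot x x <= \sum_(i | Y i) dot (x *m rG (tperm j i)) x.
Proof.
move=> rG_orth Yj x_fix.
pose f p := if Y p || (p == j) then None else Some p.
have := dot_ysum_ge0 false rG_orth f x.
rewrite (fixed_by_coset (fun s => stab_one_more s Yj) x_fix) dotZl.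
rewrite pmulr_rge0 ?card_colour_stab_gt0 // (bigD1 j) //= tperm1 repr_mx1 mulmx1.
rewrite dotDl dotC dot_sumr -lerBlDl sub0r => /le_trans-> //.
rewrite le_eqVlt; apply/orP; left; apply/eqP; apply: eq_big => [i|i _].
  rewrite /f eqxx orbT; case: (eqVneq i j) => [->|neq_ij].
    by rewrite (negPf Yj) andbF.
  by rewrite orbF andbT; case: (Y i).
exact: dotC.
Qed.

End FixedVectors.

Lemma sum_by_value (V : nmodType) (I : finType) (P : pred I) (f : I -> nat) b
    (F : I -> V) :
  (\sum_(i | P i && (f i < b)%N) F i = \sum_(r < b) \sum_(i | P i && (f i == r)) F i)%R.
Proof.
elim: b => [|b IHb]; first by rewrite big_ord0 big_pred0 // => i; rewrite andbF.
rewrite big_ord_recr -IHb (bigID (fun i => f i == b)) /= addrC.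
congr (_ + _)%R; apply: eq_bigl => i; case: (P i) => //=.
  by rewrite ltnS ltn_neqAle andbC.
by case: eqP => [->|]; rewrite ?andbT ?andbF // ltnSn.
Qed.

(** * Highest weight vectors survive the Young symmetrizer *)

Section HighestWeightVector.
Local Open Scope ring_scope.
Variables (n d : nat) (rG : mx_representation rat [set: 'S_n]%G d).
Variables (nu : young_diagram n) (x : 'rV[rat]_d).
Hypothesis rG_orth : orthogonal_repr rG.
Hypothesis x_fix : fixed_by rG (box_row nu) x.
(** This is the vanishing of the raising operator that moves box [j] up to row [r]: the identity and
    the transpositions of [j] with row [r] sum to zero on [x]. *)
Hypothesis x_raise : forall j r, (r < box_row nu j)%N ->
  \sum_(i | box_row nu i == r) x *m rG (tperm j i) = - x.

(* The boxes are processed column by column, each column from top to bottom. *)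
Let key (p : 'I_n) := (box_col nu p * size nu + box_row nu p)%N.

Let key_lt p q : (key p < key q)%N = (box_col nu p < box_col nu q)%N ||
  (box_col nu p == box_col nu q) && (box_row nu p < box_row nu q)%N.
Proof.
have row_lt r : (box_row nu r < size nu)%N.
  by rewrite -nth_diagram_gt0 (leq_ltn_trans _ (box_col_lt nu r)).
have := row_lt p; have := row_lt q; rewrite /key.
by case: (ltngtP (box_col nu p) (box_col nu q)) => [||->] /=; nia.
Qed.

Let key_inj p q : key p = key q -> p = q.
Proof.
move=> eq_key; have := key_lt p q; have := key_lt q p; rewrite eq_key ltnn.
case: (ltngtP (box_col nu p) (box_col nu q)) => //= cpq.
by case: (ltngtP (box_row nu p) (box_row nu q)) => //= rpq _ _; apply: (box_inj rpq).
Qed.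

(** Boxes already processed are coloured by their column and the others stay apart, so the
    stabilisers grow from the trivial group to the column group. *)
Let colour k (p : 'I_n) : nat + 'I_n :=
  if (key p < k)%N then inl (box_col nu p) else inr p.

Let stab_colour_fix k q p : q \in colour_stab (colour k) -> (k <= key p)%N -> q p = p.
Proof.
move=> /colour_stabP/(_ p) + le_k; rewrite /colour (ltnNge (key p)) le_k /=.
by case: ifP => // _ [].
Qed.

Let stab_colour_col k q p : q \in colour_stab (colour k) -> (key p < k)%N ->
  (key (q p) < k)%N /\ box_col nu (q p) = box_col nu p.
Proof.
move=> /colour_stabP/(_ p) + lt_k; rewrite /colour lt_k.
by case: ifP => // _ [].
Qed.

Let E k := ysum rG true (colour k).

(** The group of stage [k] fixes [j], so conjugation by it only permutes the transpositions of [j]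
    with the elements of [S]. *)
Let tperm_sum_comm k j (S : pred 'I_n) : (k <= key j)%N ->
    (forall q i, q \in colour_stab (colour k) -> S i -> S (q i)) ->
  (\sum_(i | S i) rG (tperm j i)) *m E k = E k *m \sum_(i | S i) rG (tperm j i).
Proof.
move=> le_k S_stab; rewrite /E /ysum mulmx_sumr mulmx_suml.
apply: eq_bigr => q Gq; rewrite -scalemxAr -scalemxAl; congr (_ *: _).
have S_q i : S (q i) = S i.
  apply/idP/idP => [|]; last exact: S_stab.
  by move=> /(S_stab q^-1%g); rewrite permK; apply; rewrite groupV.
rewrite [in RHS](reindex_inj (@perm_inj _ q)) mulmx_suml mulmx_sumr.
apply: eq_big => [i|i _]; first by rewrite S_q.
rewrite -!repr_permM; congr (rG _).
by rewrite -{2}(stab_colour_fix Gq le_k) -tpermJ conjgE !mulgA mulgV mul1g.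
Qed.

(** Suppose that box [j], in row [b] and column [c], made the vector vanish. The raising relations
    would then express -(b+1) y as a sum over the boxes above row [b] and right of column [c]. The
    pairing of that sum with y is at least -b |y|^2, by [dot_tperm_sum_ge] for each of the [b] rows,
    so y = 0. *)
Let step k j : key j = k -> x *m E k != 0 -> x *m E k.+1 != 0.
Proof.
move=> key_j; set y := x *m E k => nz_y.
pose c := box_col nu j; pose b := box_row nu j.
pose S i := (box_row nu i < b)%N && (c <= box_col nu i)%N.
have S_stab q i : q \in colour_stab (colour k) -> S i -> S (q i).
  move=> Gq /andP[lt_b le_c]; case: (ltnP (key i) k) => [lt_k|le_k].
    have [] := stab_colour_col Gq lt_k; move: lt_k; rewrite -key_j !key_lt /S -/c -/b.
    by move=> _ + cq; rewrite cq (ltnNge _ c) le_c /= => /andP[_ ->].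
  by rewrite (stab_colour_fix Gq le_k) /S lt_b.
(* With [i'] the box of row [b] in the column of [i], [x] is fixed by [tperm j i'], which moves past
   [tperm j i] as [tperm i i']; the latter is antisymmetrized by [E k]. *)
have zero i : (box_row nu i < b)%N -> (box_col nu i < c)%N ->
    x *m rG (tperm j i) *m E k = 0.
  move=> lt_b lt_c.
  have [i' [row_i' col_i']] : exists i', box_row nu i' = b /\ box_col nu i' = box_col nu i.
    by apply: box_ex; apply: ltn_trans lt_c (box_col_lt nu j).
  have lt_i : (key i < k)%N by rewrite -key_j key_lt lt_c.
  have lt_i' : (key i' < k)%N by rewrite -key_j key_lt col_i' lt_c.
  have eq_t : (tperm j i' * tperm j i = tperm j i * tperm i i')%g.
    have -> : tperm i i' = (tperm j i' ^ tperm j i)%g.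
      rewrite tpermJ tpermL tpermD //; apply/eqP => eq_i'.
        by move: lt_c; rewrite -col_i' -eq_i' ltnn.
      by move: lt_b; rewrite eq_i' row_i' ltnn.
    by rewrite conjgE !mulgA mulgV mul1g.
  have x_i' : x *m rG (tperm j i') = x by apply/x_fix/tperm_colour_stab.
  have t_stab : tperm i i' \in colour_stab (colour k).
    by apply: tperm_colour_stab; rewrite /colour lt_i lt_i' col_i'.
  have neq_ii' : i != i' by apply: contraTneq lt_b => ->; rewrite row_i' ltnn.
  have : x *m rG (tperm j i) *m E k = - (x *m rG (tperm j i) *m E k).
    rewrite -{1}x_i' -(mulmxA x) -repr_permM eq_t repr_permM -!mulmxA ysum_mull //.
    by rewrite psign_tperm // expr1 scaleN1r !mulmxN.
  move/eqP; rewrite -addr_eq0 -mulr2n -scaler_nat scaler_eq0 /=.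
  by move/eqP.
(* The raising relations of the [b] rows above are added up; the boxes left of column [c] contribute
   nothing. *)
have sum_S : \sum_(i | S i) y *m rG (tperm j i) = - (b%:R *: y).
  have le_k : (k <= key j)%N by rewrite key_j.
  rewrite -mulmx_sumr /y -mulmxA -(tperm_sum_comm le_k S_stab).
  have : (\sum_(i | (box_row nu i < b)%N) x *m rG (tperm j i)) *m E k = - (b%:R *: y).
    rewrite (sum_by_value predT) /= (eq_bigr (fun _ => - x)) => [|r _].
      by rewrite sumr_const card_ord -scaler_nat -scalemxAl mulNmx scalerN.
    exact: x_raise.
  rewrite (bigID (fun i => c <= box_col nu i)%N) /= mulmxDl.
  rewrite [X in _ + X = _]mulmx_suml [X in _ + X = _]big1 => [|i /andP[lt_b]].
    by rewrite addr0 => <-; rewrite mulmxA (mulmx_sumr x).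
  by rewrite -ltnNge; apply: zero.
have y_next : x *m E k.+1 = y -
    \sum_(i | (box_row nu i < b)%N && (box_col nu i == c)) y *m rG (tperm j i).
  have colour_next p : p != j -> colour k.+1 p = colour k p.
    move=> neq_pj; rewrite /colour ltnS leq_eqVlt -key_j; case: eqP => // /key_inj eq_pj.
    by rewrite eq_pj eqxx in neq_pj.
  have stab_next s : (s \in colour_stab (colour k)) =
      (s \in colour_stab (colour k.+1)) && (s j == j).
    apply/idP/andP => [s_k|[/colour_stabP s_k /eqP sj]]; [have sj : s j = j|].
    - by rewrite (stab_colour_fix s_k) ?key_j.
    - split; last exact/eqP; apply/colour_stabP => p.
      have [->|neq_pj] := eqVneq p j; first by rewrite sj.
      rewrite !colour_next //; first exact: (colour_stabP _ _ s_k).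
      by rewrite -{1}sj (inj_eq perm_inj).
    - apply/colour_stabP => p; have [->|neq_pj] := eqVneq p j; first by rewrite sj.
      rewrite -(colour_next p) // -(colour_next (s p)) ?s_k //.
      by rewrite -{1}sj (inj_eq perm_inj).
  rewrite /E (ysum_coset _ _ stab_next) mulmx_sumr (bigD1 j) //=.
  rewrite tperm1 repr_mx1 psign1 scale1r mulmx1 -sumrN; congr (_ + _).
  apply: eq_big => [i|i /andP[_ neq_ij]]; last first.
    by rewrite psign_tperm 1?eq_sym // expr1 scaleN1r mulmxN mulmxA.
  have colour_j : colour k.+1 j = inl c by rewrite /colour key_j ltnSn.
  rewrite colour_j; have [->|neq_ij] := eqVneq i j; first by rewrite ltnn andbF.
  rewrite andbT colour_next // /colour -key_j key_lt -/c -/b.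
  have [->|neq_c] := eqVneq (box_col nu i) c; last first.
    by rewrite andbF; case: ifP => // _; apply/negP => /eqP[/eqP]; apply/negP.
  by rewrite ltnn /=; case: ifP => _; rewrite ?eqxx.
rewrite y_next; apply: contraNneq nz_y => /eqP; rewrite subr_eq0 => /eqP y_col.
have sum_right : \sum_(i | (c < box_col nu i)%N && (box_row nu i < b)%N)
    y *m rG (tperm j i) = - (b.+1%:R *: y).
  have sum_col : \sum_(i | S i && (box_col nu i == c)) y *m rG (tperm j i) = y.
    rewrite {2}y_col; apply: eq_bigl => i; rewrite /S.
    by case: (eqVneq (box_col nu i) c) => [->|]; rewrite ?leqnn ?andbT ?andbF.
  have := sum_S; rewrite (bigID (fun i => box_col nu i == c)) /= sum_col.
  move=> /(canRL (addKr y)) sum_r.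
  rewrite -natr1 scalerDl scale1r opprD addrC -sum_r; apply: eq_bigl => i.
  by rewrite /S -andbA andbC; congr (_ && _); rewrite ltn_neqAle andbC eq_sym.
(* Permutations of one row to the right of column [c] fix [x], and they commute with [E k], whose
   group only moves boxes processed before [j]. *)
have y_fix r : (r < b)%N -> fixed_by rG (fun p =>
    if (c < box_col nu p)%N && (box_row nu p == r) then None else Some p) y.
  move=> lt_r t t_Y.
  have t_out p : ~~ ((c < box_col nu p)%N && (box_row nu p == r)) -> t p = p.
    by move=> /negPf Yp; have := colour_stabP _ _ t_Y p; rewrite Yp; case: ifP => // _ [].
  have t_in p : (c < box_col nu p)%N && (box_row nu p == r) ->
      (c < box_col nu (t p))%N && (box_row nu (t p) == r).
    by move=> Yp; have := colour_stabP _ _ t_Y p; rewrite Yp; case: ifP.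
  have Y_key p : (c < box_col nu p)%N && (box_row nu p == r) -> (k <= key p)%N.
    by move=> /andP[lt_c _]; rewrite leqNgt -key_j key_lt -/c ltnNge ltnW // gtn_eqF.
  have x_t : x *m rG t = x.
    apply: x_fix; apply/colour_stabP => p.
    have [Yp|/t_out->//] := boolP ((c < box_col nu p)%N && (box_row nu p == r)).
    by have /andP[_ /eqP->] := t_in p Yp; have /andP[_ /eqP->] := Yp.
  rewrite /y -mulmxA; suff -> : E k *m rG t = rG t *m E k by rewrite mulmxA x_t.
  rewrite /E /ysum mulmx_suml mulmx_sumr; apply: eq_bigr => q Gq.
  rewrite -scalemxAl -scalemxAr -!repr_permM; congr (_ *: rG _).
  apply/permP => p; rewrite !permM.
  have [Yp|Yp] := boolP ((c < box_col nu p)%N && (box_row nu p == r)).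
    by rewrite !(stab_colour_fix Gq) // Y_key // t_in.
  rewrite (t_out p) //; apply: t_out; apply: contra Yp => Yqp.
  by rewrite -(perm_inj (stab_colour_fix Gq (Y_key _ Yqp))).
rewrite -dot_eq0 eq_le dot_ge0 andbT.
have : dot (\sum_(i | (c < box_col nu i)%N && (box_row nu i < b)%N)
    y *m rG (tperm j i)) y = - b.+1%:R * dot y y by rewrite sum_right -scaleNr dotZl.
rewrite sum_by_value dotC dot_sumr.
have : - b%:R * dot y y <= \sum_(r < b) dot y
    (\sum_(i | (c < box_col nu i)%N && (box_row nu i == r)) y *m rG (tperm j i)).
  apply: (@le_trans _ _ (\sum_(r < b) - dot y y)).
    by rewrite sumr_const card_ord mulNrn mulNr mulr_natl.
  apply: ler_sum => r _.
  have Yj : ~~ ((c < box_col nu j)%N && (box_row nu j == r)) by rewrite ltnn.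
  apply: le_trans (dot_tperm_sum_ge rG_orth Yj (y_fix r (ltn_ord r))) _.
  by rewrite dot_sumr ler_sum // => i _; rewrite dotC.
by rewrite -natr1; lra.
Qed.

Lemma ycol_highest_weight_neq0 : x != 0 -> x *m ycol rG nu != 0.
Proof.
move=> nz_x; have nz_E k : x *m E k != 0.
  elim: k => [|k IHk].
    suff -> : E 0 = 1%:M by rewrite mulmx1.
    rewrite /E /ysum (big_pred1 1%g) ?psign1 ?scale1r ?repr_mx1 // => q.
    apply/idP/eqP => [q_fix|->]; last exact: group1.
    by apply/permP => p; rewrite perm1 (stab_colour_fix q_fix).
  have [/existsP[j /eqP key_j]|no_j] := boolP [exists j, key j == k].
    exact: step key_j IHk.
  suff -> : E k.+1 = E k by [].
  apply: eq_bigl => q; have eq_colour p : colour k.+1 p = colour k p.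
    rewrite /colour ltnS leq_eqVlt; case: eqP => // key_p.
    by case/existsP: no_j; exists p; apply/eqP.
  by apply/colour_stabP/colour_stabP => q_k p; have := q_k p; rewrite !eq_colour.
suff <- : E (\max_p key p).+1 = ycol rG nu by [].
apply: eq_bigl => q; have eq_colour p : colour (\max_p key p).+1 p = inl (box_col nu p).
  by rewrite /colour ltnS leq_bigmax.
apply/colour_stabP/colour_stabP => q_k p; have := q_k p; rewrite !eq_colour.
  by case.
by move=> ->.
Qed.

(** As [x] is fixed by the row group, pairing its symmetrization with [x] gives a positive multiple
    of the squared norm of [x *m ycol rG nu]. *)
Lemma ysym_highest_weight_neq0 : x != 0 -> x *m ysym rG nu != 0.
Proof.
move=> /ycol_highest_weight_neq0; apply: contraNneq => xC0.
have : dot (x *m ysym rG nu) x = 0 by rewrite xC0 /dot mul0mx mxE.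
rewrite /ysym mulmxA dot_mulmx ysum_tr // (fixed_by_ysum x_fix) dotZr.
move/eqP; rewrite mulf_eq0 (gt_eqF (card_colour_stab_gt0 _)) /= => /eqP col0.
have := dot_ysum true rG_orth (box_col nu) x x.
by rewrite -/(ycol _ _) col0 mulr0 => /esym/eqP; rewrite dot_eq0.
Qed.

End HighestWeightVector.

(** * Every nonzero stable subspace contains a highest weight vector *)

Section Completeness.
Local Open Scope ring_scope.
Variables (n d : nat) (rG : mx_representation rat [set: 'S_n]%G d).
Hypothesis rG_orth : orthogonal_repr rG.

(** Among the nonzero vectors of [U] fixed by the stabiliser of a colouring, one with the least sum
    of colours is taken. Minimality forces the colour classes to decrease in size, which gives a
    diagram, and it kills the raised vectors, whose colourings have smaller sums. *)
Lemma ysym_complete k (U : 'M_(k, d)) :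
    (forall s, (U *m rG s <= U)%MS) -> U != 0 ->
  exists nu (x : 'rV_d), (x <= U)%MS /\ x *m ysym rG nu != 0.
Proof.
move=> U_stab nz_U.
have U_act x s : (x <= U)%MS -> (x *m rG s <= U)%MS.
  by move=> Ux; apply: submx_trans (U_stab s); rewrite submxMr.
pose Q N := exists (f : 'I_n -> nat) (x : 'rV_d),
  [/\ (\sum_p f p)%N = N, (x <= U)%MS, x != 0 & fixed_by rG f x].
have exQ : exists N, `[< Q N >].
  (* Distinct colours have a trivial stabiliser, so any nonzero vector qualifies. *)
  exists (\sum_(p < n) p)%N; apply/asboolP; exists val, (nz_row U); split => //.
  - exact: nz_row_sub.
  - by rewrite nz_row_eq0.
  move=> s /colour_stabP s_id; suff -> : s = 1%g by rewrite repr_mx1 mulmx1.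
  by apply/permP => p; rewrite perm1; apply: val_inj; apply: s_id.
case: (ex_minnP exQ) => N /asboolP[f [x [sum_f Ux nz_x x_fix]]] N_min.
have f_min (g : 'I_n -> nat) y : (\sum_p g p < \sum_p f p)%N -> (y <= U)%MS ->
    fixed_by rG g y -> y = 0.
  move=> lt_g Uy y_fix; apply/eqP; apply: contraLR lt_g => nz_y; rewrite -leqNgt sum_f.
  by apply: N_min; apply/asboolP; exists g, y.
have [|nu [s row_s]] := @diagram_of_colouring n f.
  move=> r t lt_rt; rewrite leqNgt; apply/negP => lt_card.
  (* Exchanging two colours keeps the stabiliser, and lowers the sum when the larger colour is the
     more frequent one. *)
  pose sw v := if v == r then t else if v == t then r else v.
  have swK : involutive sw.
    move=> v; rewrite /sw; have [->|neq_r] := eqVneq v r.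
      by rewrite eqxx; case: eqP.
    have [->|neq_t] := eqVneq v t; first by rewrite eqxx.
    by rewrite (negPf neq_r) (negPf neq_t).
  have /f_min/(_ Ux) : (\sum_p sw (f p) < \sum_p f p)%N.
    have sum_sw (g : nat -> nat) : (\sum_p g (f p) =
        #|[pred p | f p == r]| * g r + #|[pred p | f p == t]| * g t +
        \sum_(p | (f p != r) && (f p != t)) g (f p))%N.
      rewrite (bigID (fun p => f p == r)) (bigID (fun p => f p == t) (fun p => f p != r)).
      rewrite /= addnA; congr (_ + _ + _)%N; rewrite -sum_nat_const.
        by apply: eq_big => p; rewrite ?inE // => /eqP->.
      apply: eq_big => [p|p /andP[_ /eqP->] //].
      by rewrite inE; case: (eqVneq (f p) t) => [->|_]; rewrite ?andbF // gtn_eqF.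
    rewrite sum_sw (sum_sw id) /= {1 2}/sw eqxx.
    have -> : (t == r) = false by rewrite gtn_eqF.
    rewrite eqxx (eq_bigr f) => [|p /andP[/negPf fr /negPf ft]]; last by rewrite /sw fr ft.
    rewrite ltn_add2r; nia.
  move=> x0; case/eqP: nz_x; apply: x0 => u u_sw; apply: x_fix.
  apply/colour_stabP => p; have := colour_stabP _ _ u_sw p.
  exact: (can_inj swK).
have sum_row : (\sum_p box_row nu p = \sum_p f p)%N.
  by rewrite [RHS](reindex_inj (@perm_inj _ s)); apply: eq_bigr => p _; rewrite row_s.
pose y := x *m rG s^-1%g.
have Uy : (y <= U)%MS by apply: U_act.
have y_fix : fixed_by rG (box_row nu) y.
  move=> t /colour_stabP t_row; rewrite /y -mulmxA -repr_permM.
  have -> : (s^-1 * t = (s^-1 * t * s) * s^-1)%g by rewrite mulgK.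
  rewrite repr_permM mulmxA x_fix //; apply/colour_stabP => p.
  by rewrite !permM row_s t_row -row_s permKV.
have nz_y : y != 0.
  apply: contraNneq nz_x => y0.
  by rewrite -(mulmx1 x) -(repr_mx1 rG) -(mulVg s) repr_permM mulmxA -/y y0 mul0mx.
exists nu, y; split=> //; apply: ysym_highest_weight_neq0 => // j r lt_r.
(* The colouring [g] has [j] moved up to row [r]; [g'] also keeps [j] apart, so its stabiliser lies
   in the row group. Symmetrizing [y] over [g] must give 0, and this is the raising relation. *)
pose g (p : 'I_n) := if p == j then r else box_row nu p.
pose g' (p : 'I_n) := (g p, p == j).
have stab_g' t : (t \in colour_stab g') = (t \in colour_stab g) && (t j == j).
  apply/colour_stabP/andP => [t_g'|[/colour_stabP t_g /eqP tj] p].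
    split; first by apply/colour_stabP => p; case: (t_g' p).
    by case: (t_g' j) => _ ->.
  by rewrite /g' t_g; congr (_, _); rewrite -{1}tj (inj_eq perm_inj).
have y_g' : fixed_by rG g' y.
  move=> t t_g'; apply: y_fix; apply/colour_stabP => p.
  have [gt tj] : g (t p) = g p /\ (t p == j) = (p == j).
    by case: (colour_stabP _ _ t_g' p).
  have [eq_pj|neq_pj] := eqVneq p j.
    by move: tj; rewrite eq_pj eqxx => /eqP->.
  by move: gt; rewrite /g tj (negPf neq_pj).
have lt_g : (\sum_p g p < \sum_p f p)%N.
  rewrite -sum_row (bigD1 j) //= [X in (_ < X)%N](bigD1 j) //= {1}/g eqxx.
  by rewrite (eq_bigr (box_row nu)) ?ltn_add2r // => p /negPf; rewrite /g => ->.
have yg : y *m ysum rG false g = 0.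
  apply: (f_min g) => //; last exact: ysum_fixed_by.
  rewrite (fixed_by_coset stab_g' y_g').
  by apply: scalemx_sub; apply: summx_sub => i _; apply: U_act.
move/eqP: yg; rewrite (fixed_by_coset stab_g' y_g').
rewrite scaler_eq0 (gt_eqF (card_colour_stab_gt0 _)) /=.
rewrite (bigD1 j) //= tperm1 repr_mx1 mulmx1 addrC addr_eq0 => /eqP <-.
apply: eq_bigl => i; rewrite /g eqxx; case: (eqVneq i j) => [->|_].
  by rewrite andbF gtn_eqF.
by rewrite andbT.
Qed.

End Completeness.

(** * Tensors *)

Lemma prod_natr_bool (I : finType) (b : pred I) :
  (\prod_p (b p)%:R = [forall p, b p]%:R :> rat)%R.
Proof.
have [/forallP b_all|] := boolP [forall p, b p]; first by rewrite big1 // => p _; rewrite b_all.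
by rewrite negb_forall => /existsP[p /negPf bp]; rewrite (bigD1 p) //= bp mul0r.
Qed.

Section TensorIndex.
Local Open Scope ring_scope.
Variable m : nat.

(** The first tensor factor is split off by [mxtens_unindex] and the others come by induction; the
    powers 0 and 1 are separate because the recursion starts at the power 1. *)
Lemma ntensmx_index n : exists idx : 'I_(m ^ n) -> {ffun 'I_n -> 'I_m},
  injective idx /\ forall (A : 'M[rat]_m) i j,
    (A ^t n) i j = \prod_p A (idx i p) (idx j p).
Proof.
case: n => [|n].
  exists (fun i => [ffun p : 'I_0 => False_rect 'I_m (notF (ltn_ord p))]).
  split=> [i j _|A i j]; first by apply: val_inj; rewrite [i]ord1 [j]ord1.
  by rewrite big_ord0 ntensmx0 mxE [i]ord1 [j]ord1 eqxx.
elim: n => [|n [idx [idx_inj idxE]]].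
  exists (fun i => [ffun=> i : 'I_m]); split=> [i j /ffunP/(_ ord0)|A i j].
    by rewrite !ffunE.
  by rewrite big_ord1 !ffunE ntensmx1.
exists (fun i => [ffun p => oapp (idx (mxtens_unindex (n := m ^ n.+1) i).2)
                                 (mxtens_unindex (n := m ^ n.+1) i).1 (unlift ord0 p)]).
split=> [i j /ffunP eq_ij|A i j].
  apply: (can_inj (@mxtens_unindexK m (m ^ n.+1))).
  rewrite [LHS]surjective_pairing [RHS]surjective_pairing; congr (_, _).
    by have := eq_ij ord0; rewrite !ffunE unlift_none.
  apply: idx_inj; apply/ffunP => p.
  by have := eq_ij (lift ord0 p); rewrite !ffunE liftK.
rewrite ntensmxSS mxE big_ord_recl !ffunE unlift_none /= idxE; congr (_ * _).
by apply: eq_bigr => p _; rewrite !ffunE liftK.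
Qed.

Variable n : nat.

Definition tidx : 'I_(m ^ n) -> {ffun 'I_n -> 'I_m} := sval (cid (ntensmx_index n)).

Lemma tidx_inj : injective tidx.
Proof. by have [] := svalP (cid (ntensmx_index n)). Qed.

Lemma ntensmxE (A : 'M[rat]_m) i j : (A ^t n) i j = \prod_p A (tidx i p) (tidx j p).
Proof. by have [_] := svalP (cid (ntensmx_index n)); apply. Qed.

Lemma tidx_bij : bijective tidx.
Proof.
by apply: (inj_card_bij tidx_inj); rewrite card_ffun !card_ord.
Qed.

Lemma tidx_surj f : exists i, tidx i == f.
Proof. by case: tidx_bij => g _ gK; exists (g f); rewrite gK. Qed.

Definition tensor_index (f : {ffun 'I_n -> 'I_m}) : 'I_(m ^ n) :=
  xchoose (tidx_surj f).

Lemma tensor_indexK : cancel tensor_index tidx.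
Proof. by move=> f; apply/eqP; apply: (xchooseP (tidx_surj f)). Qed.

Lemma tidxK : cancel tidx tensor_index.
Proof. by move=> i; apply: tidx_inj; rewrite tensor_indexK. Qed.

Definition perm_index (s : 'S_n) (i : 'I_(m ^ n)) : 'I_(m ^ n) :=
  tensor_index [ffun p => tidx i (s p)].

Lemma tidx_perm_index s i p : tidx (perm_index s i) p = tidx i (s p).
Proof. by rewrite tensor_indexK ffunE. Qed.

Lemma perm_indexM s t i : perm_index (s * t)%g i = perm_index s (perm_index t i).
Proof. by apply: tidx_inj; apply/ffunP => p; rewrite !tidx_perm_index permM. Qed.

Lemma perm_index1 i : perm_index 1%g i = i.
Proof. by apply: tidx_inj; apply/ffunP => p; rewrite !tidx_perm_index perm1. Qed.

Lemma perm_indexK s : cancel (perm_index s) (perm_index s^-1%g).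
Proof. by move=> i; rewrite -perm_indexM mulVg perm_index1. Qed.

Lemma perm_indexKV s : cancel (perm_index s^-1%g) (perm_index s).
Proof. by move=> i; rewrite -perm_indexM mulgV perm_index1. Qed.

Definition tensor_perm_mx (s : 'S_n) : 'M[rat]_(m ^ n) :=
  \matrix_(i, j) (i == perm_index s j)%:R.

Lemma mul_tensor_perm_mx k (v : 'M_(k, m ^ n)) s i j :
  (v *m tensor_perm_mx s) i j = v i (perm_index s j).
Proof.
rewrite mxE (bigD1 (perm_index s j)) //= mxE eqxx mulr1.
by rewrite big1 ?addr0 // => l /negPf l_neq; rewrite mxE l_neq mulr0.
Qed.

Lemma tensor_perm_mx_repr : mx_repr [set: 'S_n] tensor_perm_mx.
Proof.
split=> [|s t _ _]; apply/matrixP => i j.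
  by rewrite !mxE perm_index1.
by rewrite mul_tensor_perm_mx !mxE perm_indexM.
Qed.
Canonical tensor_repr := MxRepresentation tensor_perm_mx_repr.

Lemma tensor_repr_orthogonal : orthogonal_repr tensor_repr.
Proof.
move=> s; apply/matrixP => i j; rewrite !mxE; congr (nat_of_bool _)%:R.
by rewrite -(can2_eq (@perm_indexKV s) (@perm_indexK s)) eq_sym.
Qed.

Lemma ntensmx_tensor_repr (A : 'M_m) s :
  A ^t n *m tensor_repr s = tensor_repr s *m A ^t n.
Proof.
apply/matrixP => i j; rewrite mul_tensor_perm_mx ntensmxE.
rewrite mxE (bigD1 (perm_index s^-1%g i)) //= [X in _ + X]big1 => [|l /negPf neq_l].
  rewrite addr0 mxE perm_indexKV eqxx mul1r ntensmxE.
  rewrite [RHS](reindex_inj (@perm_inj _ s)); apply: eq_bigr => p _.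
  by rewrite !tidx_perm_index permK.
by rewrite mxE eq_sym (can2_eq (@perm_indexK s) (@perm_indexKV s)) neq_l mul0r.
Qed.

(* The pairing of v with the tensor product of the rows of w. *)
Definition tensor_eval (v : 'rV[rat]_(m ^ n)) (w : 'M[rat]_(n, m)) : rat :=
  \sum_i v 0 i * \prod_p w p (tidx i p).

Lemma tensor_eval_perm v s w :
  tensor_eval (v *m tensor_repr s) w = tensor_eval v (row_perm s w).
Proof.
rewrite /tensor_eval (reindex_inj (can_inj (@perm_indexK s^-1%g))) /=.
apply: eq_bigr => i _; rewrite mul_tensor_perm_mx perm_indexKV; congr (_ * _).
rewrite (reindex_inj (@perm_inj _ s)); apply: eq_bigr => p _.
by rewrite tidx_perm_index permK mxE.
Qed.

Lemma tensor_eval_ntensmx v (A : 'M_m) w :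
  tensor_eval (v *m A ^t n) w = tensor_eval v (w *m A^T).
Proof.
rewrite /tensor_eval; under eq_bigr => j _ do rewrite mxE mulr_suml.
rewrite exchange_big; apply: eq_bigr => i _ /=.
under eq_bigr => j _ do rewrite -mulrA ntensmxE -big_split /=.
rewrite -mulr_sumr; congr (_ * _).
under [RHS]eq_bigr => p _ do rewrite mxE.
rewrite bigA_distr_bigA (reindex tidx) /=; last first.
  by exists tensor_index => j _; rewrite ?tidxK ?tensor_indexK.
by apply: eq_bigr => j _; apply: eq_bigr => p _; rewrite mxE mulrC.
Qed.

Lemma tensor_evalZ a v w : tensor_eval (a *: v) w = a * tensor_eval v w.
Proof.
by rewrite /tensor_eval mulr_sumr; apply: eq_bigr => i _; rewrite mxE mulrA.
Qed.

Lemma tensor_evalB u v w : tensor_eval (u - v) w = tensor_eval u w - tensor_eval v w.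
Proof.
by rewrite /tensor_eval -sumrB; apply: eq_bigr => i _; rewrite !mxE mulrBl.
Qed.

Lemma tensor_eval_sum (I : finType) (P : pred I) v w :
  tensor_eval (\sum_(i | P i) v i) w = \sum_(i | P i) tensor_eval (v i) w.
Proof.
rewrite /tensor_eval exchange_big; apply: eq_bigr => i _ /=.
by rewrite summxE mulr_suml.
Qed.

Lemma tensor_eval_ysum v sg (T : eqType) (f : 'I_n -> T) w :
  tensor_eval (v *m ysum tensor_repr sg f) w =
  \sum_(s in colour_stab f) psign sg s * tensor_eval v (row_perm s w).
Proof.
rewrite /ysum mulmx_sumr tensor_eval_sum; apply: eq_bigr => s _.
by rewrite -scalemxAr tensor_evalZ tensor_eval_perm.
Qed.

(* Polarization: by inclusion-exclusion over the sets S of positions, the tensor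
   e_(i 1) ... e_(i n), symmetrized over the blocks of f, is an alternating sum of
   tensors that are constant on these blocks. *)
Lemma tensor_eval_polar v k (f : 'I_n -> 'I_k) :
    (forall s, s \in colour_stab f -> v *m tensor_repr s = v) ->
    (forall M : 'M_(k, m), tensor_eval v (rowsub f M) = 0) ->
  v = 0.
Proof.
move=> v_fix v_eval0; apply/rowP => i; rewrite mxE.
(* Row [r] is the sum of the basis vectors attached by [i] to the positions of [S] in block [r].
   Expanding the product below, [h] selects one position in the block of each [p]. *)
pose M (S : {ffun 'I_n -> bool}) : 'M[rat]_(k, m) :=
  \matrix_(r, a) \sum_(q | f q == r) (S q && (tidx i q == a))%:R.
pose F := family (fun p q => f q == f p).
have M_prod S l : \prod_p rowsub f (M S) p (tidx l p) =
    \sum_(h in F) (\prod_p (S (h p))%:R) * (tensor_index [ffun p => tidx i (h p)] == l)%:R.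
  under eq_bigr => p _ do rewrite !mxE.
  rewrite bigA_distr_big_dep; apply: eq_bigr => h _.
  rewrite (eq_bigr (fun p => (S (h p))%:R * (tidx i (h p) == tidx l p)%:R)) => [|p _].
    rewrite big_split /=; congr (_ * _); rewrite prod_natr_bool; congr (nat_of_bool _)%:R.
    apply/forallP/eqP => [eq_l|<- p]; last by rewrite tensor_indexK ffunE.
    by rewrite -(tidxK l); congr tensor_index; apply/ffunP => p; rewrite ffunE (eqP (eq_l p)).
  by rewrite -natrM mulnb.
(* A position outside the image of [h] makes the alternating sum cancel, so only permutations
   survive. *)
have S_sum (h : {ffun 'I_n -> 'I_n}) : \sum_(S : {ffun 'I_n -> bool})
    (\prod_q (-1) ^+ S q) * (\prod_p (S (h p))%:R) = (-1) ^+ n * (injectiveb h)%:R :> rat.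
  pose g q (b : bool) : rat := (-1) ^+ b * ((q \in codom h) ==> b)%:R.
  transitivity (\prod_q \sum_b g q b).
    rewrite bigA_distr_bigA; apply: eq_bigr => S _; rewrite big_split /=; congr (_ * _).
    rewrite !prod_natr_bool; congr (nat_of_bool _)%:R.
    apply/forallP/forallP => [S_h q|S_h p].
      by apply/implyP => /codomP[p ->].
    by have /implyP := S_h (h p); apply; apply: codom_f.
  have [/injectiveP h_inj|not_inj] := boolP (injectiveb h).
    rewrite mulr1 (eq_bigr (fun _ => -1)) ?prodr_const ?card_ord // => q _.
    by rewrite big_bool /g (inj_card_onto h_inj) //= !mulr1 mulr0 addr0 expr1.
  have /existsP[q q_out] : [exists q, q \notin codom h].
    apply: contraR not_inj => /existsPn out; apply/injectiveP.
    have: codom h =i 'I_n by move=> q; have := out q; rewrite negbK => ->.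
    move=> /eq_card/eqP/image_injP h_inj p q; exact: h_inj.
  rewrite mulr0 (bigD1 q) //= big_bool /g (negPf q_out) /= !mulr1 expr1 addrC subrr.
  by rewrite mul0r.
have : \sum_(S : {ffun 'I_n -> bool})
    (\prod_q (-1) ^+ S q) * tensor_eval v (rowsub f (M S)) = 0.
  by rewrite big1 // => S _; rewrite v_eval0 mulr0.
rewrite /tensor_eval.
have -> : \sum_(S : {ffun 'I_n -> bool}) (\prod_q (-1) ^+ S q) *
    \sum_l v 0 l * \prod_p rowsub f (M S) p (tidx l p) =
    (\sum_(h in F) (-1) ^+ n * (injectiveb h)%:R) * v 0 i.
  transitivity (\sum_(h in F) (\sum_(S : {ffun 'I_n -> bool})
      (\prod_q (-1) ^+ S q) * (\prod_p (S (h p))%:R)) *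
      v 0 (tensor_index [ffun p => tidx i (h p)])).
    under [RHS]eq_bigr => h _ do rewrite mulr_suml.
    rewrite [RHS]exchange_big /=; apply: eq_bigr => S _.
    under [RHS]eq_bigr => h _ do rewrite -mulrA.
    rewrite -mulr_sumr; congr (_ * _).
    under eq_bigr => l _ do rewrite M_prod mulr_sumr.
    rewrite exchange_big /=; apply: eq_bigr => h _.
    rewrite (bigD1 (tensor_index [ffun p => tidx i (h p)])) //= eqxx mulr1.
    rewrite [X in _ + X]big1 ?addr0 1?mulrC // => l; rewrite eq_sym => /negPf->.
    by rewrite !mulr0.
  rewrite mulr_suml; apply: eq_bigr => h /familyP F_h; rewrite S_sum.
  have [/injectiveP h_inj|] := boolP (injectiveb h); last by rewrite mulr0 !mul0r.
  congr (_ * _).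
  have s_f : perm h_inj \in colour_stab f.
    by apply/colour_stabP => p; rewrite permE; apply/eqP/F_h.
  rewrite -[in RHS](v_fix _ s_f) mul_tensor_perm_mx; congr (v 0 _).
  by congr tensor_index; apply/ffunP => p; rewrite !ffunE permE.
(* The coefficient of [v 0 i] counts, up to sign, the permutations preserving the blocks; the
   identity makes this count nonzero. *)
rewrite -mulr_sumr => /eqP; rewrite !mulf_eq0 signr_eq0 /= => /orP[|/eqP //].
rewrite psumr_eq0 => [/allP/(_ [ffun p => p])|h _]; last exact: ler0n.
rewrite mem_index_enum => /(_ isT)/implyP; rewrite pnatr_eq0 eqb0.
have -> : injectiveb [ffun p : 'I_n => p].
  by apply/injectiveP => p q; rewrite !ffunE.
suff -> : [ffun p : 'I_n => p] \in F by move=> /(_ isT).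
by apply/familyP => p; rewrite -topredE /= ffunE.
Qed.

End TensorIndex.

(** * Evaluation at rows repeated along the rows of a diagram *)

Section RowEvaluation.
Local Open Scope ring_scope.
Variables (m n k : nat) (nu : young_diagram n) (rho : 'I_n -> 'I_k).
Hypothesis rhoE : forall p, rho p = box_row nu p :> nat.

Local Notation rT := (tensor_repr m n).

Lemma colour_stab_rho : colour_stab rho = colour_stab (box_row nu).
Proof.
apply/setP => s; apply/colour_stabP/colour_stabP => s_fix p.
  by rewrite -!rhoE s_fix.
by apply: val_inj; rewrite /= !rhoE.
Qed.

Lemma tensor_eval_ysym_row (w : 'rV_(m ^ n)) M :
  tensor_eval (w *m ysym rT nu) (rowsub rho M) =
  #|colour_stab (box_row nu)|%:R * tensor_eval (w *m ycol rT nu) (rowsub rho M).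
Proof.
rewrite /ysym mulmxA tensor_eval_ysum.
rewrite (eq_bigr (fun _ => tensor_eval (w *m ycol rT nu) (rowsub rho M))) => [|s].
  by rewrite sumr_const mulr_natl.
rewrite -colour_stab_rho psign_sym mul1r => /colour_stabP s_rho; congr tensor_eval.
by apply/matrixP => p a; rewrite !mxE s_rho.
Qed.

(* On the image of the Young symmetrizer, evaluation at row vectors M_1, M_2, ...
   placed in the rows of nu is a combination of products, over the columns of nu,
   of minors built from the first rows of M. *)
Lemma tensor_eval_ysym (w : 'rV_(m ^ n)) M :
  tensor_eval (w *m ysym rT nu) (rowsub rho M) =
  #|colour_stab (box_row nu)|%:R * \sum_i w 0 i *
    \det (\matrix_(p, q) if box_col nu p == box_col nu q
                         then M (rho p) (tidx i q) else 0).
Proof.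
rewrite tensor_eval_ysym_row tensor_eval_ysum; congr (_ * _).
under eq_bigr => q _ do rewrite mulr_sumr.
rewrite exchange_big; apply: eq_bigr => i _ /=.
under eq_bigr => q _ do rewrite mulrCA.
rewrite -mulr_sumr; congr (_ * _); rewrite -det_tr /determinant.
rewrite [RHS](bigID (mem (colour_stab (box_col nu)))) /=.
rewrite [X in _ + X]big1 ?addr0 => [|q].
  apply: eq_bigr => q /colour_stabP q_col; congr (_ * _).
  by apply: eq_bigr => p _; rewrite !mxE q_col eqxx.
rewrite inE negb_forall => /existsP[p /negPf q_p].
by rewrite (bigD1 p) //= !mxE q_p mul0r mulr0.
Qed.

(** A column of a diagram contains every row above each of its boxes, so the column-block matrix of
    [L *m M] is that of [M] multiplied by the column-block matrix [E] of [L]. Numbering boxes along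
    rows makes [E] triangular. *)
Lemma tensor_eval_trig (w : 'rV_(m ^ n)) (L : 'M_k) M : is_trig_mx L ->
  tensor_eval (w *m ysym rT nu) (rowsub rho (L *m M)) =
  (\prod_p L (rho p) (rho p)) * tensor_eval (w *m ysym rT nu) (rowsub rho M).
Proof.
move=> /is_trig_mxP L_trig; rewrite !tensor_eval_ysym mulrCA; congr (_ * _).
rewrite mulr_sumr; apply: eq_bigr => i _; rewrite mulrCA; congr (_ * _).
pose E : 'M[rat]_n := \matrix_(p, q)
  if box_col nu p == box_col nu q then L (rho p) (rho q) else 0.
transitivity (\det E * \det (\matrix_(p, q) if box_col nu p == box_col nu q
                         then M (rho p) (tidx i q) else 0)); last first.
  rewrite det_trig; last first.
    apply/is_trig_mxP => p q lt_pq; rewrite mxE; case: eqP => // cpq.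
    apply: L_trig; rewrite !rhoE ltn_neqAle box_row_leq ?(ltnW lt_pq) // andbT.
    by apply: contraTneq lt_pq => rpq; rewrite (box_inj rpq cpq) ltnn.
  by congr (_ * _); apply: eq_bigr => p _; rewrite mxE eqxx.
rewrite -det_mulmx; congr (\det _); apply/matrixP => p q; rewrite !mxE.
have [cpq|cpq] := eqVneq; last first.
  rewrite big1 // => p' _; rewrite !mxE; case: eqP => [cpp'|]; rewrite ?mul0r //.
  by rewrite -cpp' (negPf cpq) mulr0.
rewrite (bigID (fun p' => box_col nu p == box_col nu p')) /= [X in _ + X]big1.
  rewrite addr0 (partition_big rho predT) //=; apply: eq_bigr => r _.
  have [le_r|lt_r] := leqP r (rho p); last first.
    by rewrite L_trig // mul0r big1 // => p' /andP[/eqP cp /eqP rp];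
       rewrite !mxE rp L_trig // !cp if_same mul0r.
  move: le_r; rewrite rhoE => /box_above[p' [rp' cp']].
  rewrite (big_pred1 p') => [|p''].
    have rho_p' : rho p' = r by apply: val_inj; rewrite /= rhoE.
    by rewrite !mxE cp' eqxx cpq eqxx rho_p'.
  apply/andP/eqP => [[/eqP cp'' /eqP rp'']|->].
    by apply: (@box_inj _ nu); rewrite ?rp' ?cp' // -rp'' rhoE.
  by rewrite cp' eqxx; split=> //; apply/eqP/val_inj; rewrite /= rhoE.
by move=> p' /negPf cp; rewrite !mxE cp mul0r.
Qed.

End RowEvaluation.

Section TallDiagrams.
Local Open Scope ring_scope.
Variables (m n : nat) (nu : young_diagram n).

(** Two boxes of the first column must carry the same basis index; exchanging them fixes the
    coordinate and changes its sign. *)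
Lemma ycol_tensor_eq0 (w : 'rV_(m ^ n)) : (m < size nu)%N ->
  w *m ycol (tensor_repr m n) nu = 0.
Proof.
move=> lt_m; apply/rowP => i; rewrite [RHS]mxE; set v := _ *m _.
have box0 (r : 'I_(size nu)) : exists p, (box_row nu p == r) && (box_col nu p == 0)%N.
  have [|p [rp cp]] := @box_ex _ nu r 0; first by rewrite nth_diagram_gt0.
  by exists p; rewrite rp cp !eqxx.
pose box r := xchoose (box0 r).
have /injectivePn[r [r' neq_r eq_i]] : ~~ injectiveb (fun r => tidx i (box r)).
  by apply: contraL lt_m => /injectiveP/leq_card; rewrite !card_ord leqNgt.
have /andP[/eqP rp /eqP cp] := xchooseP (box0 r).
have /andP[/eqP rp' /eqP cp'] := xchooseP (box0 r').
have t_col : tperm (box r) (box r') \in colour_stab (box_col nu).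
  by apply: tperm_colour_stab; rewrite cp cp'.
have neq_box : box r != box r'.
  by apply: contra neq_r => /eqP eq_box; rewrite -val_eqE /= -rp -rp' -/(box r) eq_box.
have := ycol_mulr (tensor_repr m n) t_col; rewrite odd_tperm neq_box expr1 scaleN1r.
move=> /(congr1 (fun A => (w *m A) 0 i)).
rewrite mulmxA mul_tensor_perm_mx mulmxN [in RHS]mxE -/v.
have -> : perm_index (tperm (box r) (box r')) i = i.
  apply: tidx_inj; apply/ffunP => p; rewrite tidx_perm_index.
  by case: tpermP => // ->.
by move/eqP; rewrite -addr_eq0 -mulr2n -mulr_natl mulf_eq0 => /orP[|/eqP].
Qed.

End TallDiagrams.

(** * Symplectic bases *)

Section StandardForm.
Local Open Scope ring_scope.

(** The Gram matrix of x_1, y_1, x_2, y_2, ...: it is block diagonal, so that elimination can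
    proceed one hyperbolic pair at a time. *)
Definition hyp_form (R : pzRingType) g : 'M[R]_(g.*2) := \matrix_(a, b)
  if a./2 == b./2 then (~~ odd a && odd b)%:R - (odd a && ~~ odd b)%:R else 0.

Lemma hyp_formS (R : pzRingType) g :
  hyp_form R g.+1 = block_mx (hyp_form R 1) 0 0 (hyp_form R g) :> 'M_(2 + g.*2).
Proof.
apply/matrixP => a b.
case: (split_ordP (a : 'I_(2 + g.*2))) => a' ->; case: (split_ordP (b : 'I_(2 + g.*2))) => b' ->.
- by rewrite block_mxEul !mxE.
- by rewrite block_mxEur !mxE /=; case: a' => [[|[]]].
- by rewrite block_mxEdl !mxE /=; case: b' => [[|[]]].
- by rewrite block_mxEdr !mxE /= !negbK.
Qed.

Lemma skew2 (P : 'M[{poly rat}]_2) : P^T = - P -> P = P 0 1 *: hyp_form _ 1.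
Proof.
move=> /matrixP skewP; apply/matrixP => a b; rewrite !mxE.
have skew a' b' : P a' b' = - P b' a' by have := skewP b' a'; rewrite !mxE.
have diag a' : P a' a' = 0.
  by apply/eqP; have /eqP := skew a' a'; rewrite -addr_eq0 -mulr2n -scaler_nat scaler_eq0.
have ord2 (c : 'I_2) : c = 0 \/ c = 1.
  by case: c => [[|[]] // lt_c]; [left|right]; apply: val_inj.
by case: (ord2 a) => ->; case: (ord2 b) => ->; rewrite /= ?diag ?subr0 ?mulr1 ?mulr0 //
  ?(skew 1 0) ?sub0r ?mulrN1.
Qed.

Lemma hyp_form1_sq (R : comPzRingType) : hyp_form R 1 *m hyp_form R 1 = - 1%:M.
Proof.
apply/matrixP => a b; rewrite mxE big_ord_recl big_ord1 !mxE.
by case: a => [[|[]] // ?]; case: b => [[|[]] // ?] /=;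
  rewrite !(subr0, sub0r, mulr0, mul0r, mulr1, mul1r, addr0, add0r, oppr0).
Qed.

(* Symplectic Gram-Schmidt along a curve of skew forms that starts at a multiple of
   the standard form; working with polynomials, the rows are multiplied by the
   pivot instead of dividing by it. *)
Lemma skew_elimination g (G : 'M[{poly rat}]_(g.*2)) c : c != 0 ->
    G^T = - G -> map_mx (horner_eval 0) G = c *: hyp_form rat g ->
  exists L D : 'M[{poly rat}]_(g.*2),
    [/\ is_trig_mx L, is_diag_mx D,
        forall i, (L i i).[0] != 0 /\ (D i i).[0] != 0 &
        L *m G *m L^T = D *m hyp_form _ g *m D^T].
Proof.
elim: g G c => [|g IHg] G c nz_c skewG G0.
  exists 0, 0; split=> [|||]; try exact: mx0_is_trig; try exact: mx0_is_diag; first by case.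
  by apply/matrixP; case.
pose G' : 'M_(2 + g.*2) := G.
have := submxK G'; rewrite -[LHS]/(block_mx _ _ _ _).
set P := ulsubmx G'; set B := ursubmx G'; set B' := dlsubmx G'; set C := drsubmx G'.
move=> G_block.
have [skewP eqB' skewC] : [/\ P^T = - P, B' = - B^T & C^T = - C].
  have : G'^T = - G' by [].
  rewrite -G_block tr_block_mx opp_block_mx => /eq_block_mx[-> _ eqB ->]; split => //.
  by rewrite eqB opprK.
have : map_mx (horner_eval 0) G' =
    c *: (block_mx (hyp_form rat 1) 0 0 (hyp_form rat g) : 'M_(2 + g.*2)).
  by rewrite -hyp_formS.
rewrite -G_block map_block_mx scale_block_mx !scaler0.
move=> /eq_block_mx[P0 B0 _ C0].
pose j := hyp_form {poly rat} 1; pose p := P 0 1.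
have P_j : P = p *: j := skew2 skewP.
have p0 : p.[0] = c.
  transitivity (map_mx (horner_eval 0) P 0 1); first by rewrite [RHS]mxE.
  by rewrite P0 !mxE /= subr0 mulr1.
have jT : j^T = - j.
  apply/matrixP => a b; rewrite !mxE.
  by case: a => [[|[]] // ?]; case: b => [[|[]] // ?]; rewrite /= !(subr0, sub0r, oppr0, opprK).
have jj : j *m j = - 1%:M := hyp_form1_sq _.
(* Since j^2 = -1, the inverse of [P] would be -j / p. The block elimination [T] is scaled by [p] to
   stay polynomial, and [C'] is the scaled Schur complement. *)
pose Z := B^T *m j; pose C' := p *: (p *: C - Z *m B).
pose T : 'M_(2 + g.*2) := block_mx 1%:M 0 (- Z) p%:M.
have ZT : Z^T = - (j *m B) by rewrite trmx_mul trmxK jT mulNmx.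
have TGT : T *m G' *m T^T = block_mx P 0 0 C'.
  rewrite -G_block /T eqB' tr_block_mx !mulmx_block !trmx1 trmx0 tr_scalar_mx.
  rewrite !(mul1mx, mul0mx, mulmx1, mulmx0, addr0, add0r) !mul_scalar_mx !mul_mx_scalar.
  have dl0 : - Z *m P + p *: - B^T = 0.
    rewrite P_j /Z -scalemxAr mulNmx -mulmxA jj mulmxN mulmx1 opprK scalerN.
    exact: subrr.
  have ur0 : P *m (- Z)^T + p *: B = 0.
    rewrite linearN /= ZT opprK P_j -scalemxAl mulmxA jj mulNmx mul1mx scalerN.
    exact: addNr.
  rewrite dl0 ur0 mul0mx add0r; congr block_mx.
  by rewrite /C' mulNmx addrC.
have skewC' : C'^T = - C'.
  have : (T *m G' *m T^T)^T = - (T *m G' *m T^T).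
    have skewG' : G'^T = - G' by [].
    by rewrite !trmx_mul trmxK skewG' mulNmx mulmxN mulmxA.
  by rewrite TGT tr_block_mx opp_block_mx => /eq_block_mx[].
(* At 0 the block [B] vanishes and p^2 C remains; this is why the induction allows an arbitrary
   nonzero multiple of the standard form. *)
have C'0 : map_mx (horner_eval 0) C' = (c ^+ 3) *: hyp_form rat g.
  rewrite /C' map_mxZ map_mxB map_mxZ map_mxM B0 mulmx0 subr0 C0 /= horner_evalE p0.
  by rewrite !scalerA; congr (_ *: _); ring.
have [L [D [L_trig D_diag LD0 LCL]]] := IHg _ _ (expf_neq0 3 nz_c) skewC' C'0.
(* Scaling the second vector of the pair by [p] turns [j] into [P], without a square root. *)
pose D2 : 'M[{poly rat}]_2 := diag_mx (\row_i if i == 0 then 1 else p).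
suff : exists L D : 'M[{poly rat}]_(2 + g.*2),
    [/\ is_trig_mx L, is_diag_mx D,
        forall i, (L i i).[0] != 0 /\ (D i i).[0] != 0 &
        L *m G' *m L^T = D *m (hyp_form _ g.+1 : 'M_(2 + g.*2)) *m D^T] by [].
exists (block_mx 1%:M 0 0 L *m T), (block_mx D2 0 0 D); split.
- rewrite /T mulmx_block !(mul1mx, mul0mx, mulmx1, mulmx0, addr0, add0r).
  rewrite is_trig_block_mx // eqxx scalar_mx_is_trig mul_mx_scalar /=.
  by apply/is_trig_mxP => a b lt_ab; rewrite mxE (is_trig_mxP L_trig) ?mulr0.
- by rewrite is_diag_block_mx // !eqxx diag_mx_is_diag.
- have D2_0 a : (D2 a a).[0] != 0.
    by rewrite !mxE eqxx; case: ifP => _; rewrite mulr1n ?hornerC ?oner_eq0 ?p0.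
  move=> i; rewrite /T mulmx_block !(mul1mx, mul0mx, mulmx1, mulmx0, addr0, add0r).
  case: (split_ordP i) => a ->.
    by rewrite !block_mxEul D2_0 mxE eqxx hornerC oner_eq0.
  have [La Da] := LD0 a.
  by rewrite !block_mxEdr mul_mx_scalar mxE hornerM mulf_neq0 ?p0.
rewrite trmx_mul !mulmxA -(mulmxA _ T) -(mulmxA _ _ T^T) -/G' TGT.
rewrite hyp_formS !tr_block_mx !mulmx_block !trmx0 !trmx1.
rewrite !(mul1mx, mul0mx, mulmx1, mulmx0, addr0, add0r) LCL; congr block_mx.
rewrite P_j; apply/matrixP => a b; rewrite tr_diag_mx mul_diag_mx mul_mx_diag !mxE.
by case: a => [[|[]] // ?]; case: b => [[|[]] // ?] /=;
  rewrite !(subr0, sub0r, mulr0, mul0r, mulr1, mul1r, mulrN1, mulN1r).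
Qed.

End StandardForm.

Lemma mx_entryE (R : pzRingType) m k (A : 'M[R]_(m, k)) a b :
  (A a b = ((delta_mx 0 a : 'rV_m) *m A *m (delta_mx 0 b : 'rV_k)^T) 0 0)%R.
Proof. by rewrite trmx_delta -colE mxE -rowE mxE. Qed.

(** * Symplectic matrices and the reordered symplectic basis *)

Section SymplecticMatrices.
Local Open Scope ring_scope.
Variable g : nat.
Local Notation J := (symp_mx g).

Lemma symp_mx_sq : J *m J = - 1%:M.
Proof.
rewrite /symp_mx mulmx_block !(mul1mx, mul0mx, mulmx1, mulmx0, addr0, add0r).
by rewrite [in RHS]scalar_mx_block opp_block_mx !oppr0.
Qed.

Lemma symp_mxE a b : J a b = (b == (g + a)%N :> nat)%:R - (a == (g + b)%N :> nat)%:R.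
Proof.
case: (split_ordP a) => a' ->; case: (split_ordP b) => b' ->.
- by rewrite block_mxEul mxE /= !ltn_eqF ?subrr // ltn_addr.
- rewrite block_mxEur mxE /= eqn_add2l [in RHS]eq_sym.
  have -> : (a' == (g + (g + b'))%N :> nat) = false.
    by apply: ltn_eqF; have := ltn_ord a'; lia.
  by rewrite subr0.
- rewrite block_mxEdl !mxE /= eqn_add2l.
  have -> : (b' == (g + (g + a'))%N :> nat) = false.
    by apply: ltn_eqF; have := ltn_ord b'; lia.
  by rewrite sub0r.
- by rewrite block_mxEdr mxE /= !eqn_add2l !ltn_eqF ?subrr // ltn_addr.
Qed.

Lemma SpP (S : 'M_(g + g)) : Sp S <-> S *m J *m S^T = J.
Proof.
split=> [[_ S_form]|S_J].
  apply/matrixP => a b; rewrite [RHS]mx_entryE -/(symp_form _ _) -S_form.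
  by rewrite /symp_form trmx_mul [LHS]mx_entryE !mulmxA.
split=> [|u v]; last by rewrite /symp_form trmx_mul !mulmxA -2!(mulmxA u) S_J.
have /mulmx1_unit[] : S *m (J *m S^T *m - J) = 1%:M by
  rewrite !mulmxA S_J mulmxN symp_mx_sq opprK.
by [].
Qed.

(** The inverse of [S] is - J S^T J; writing the inverse on the other side gives the relation for
    the transpose. *)
Lemma Sp_tr (S : 'M_(g + g)) : Sp S -> Sp S^T.
Proof.
move=> /SpP S_J; apply/SpP; rewrite trmxK.
have /mulmx1C : S *m (J *m S^T *m - J) = 1%:M.
  by rewrite !mulmxA S_J mulmxN symp_mx_sq opprK.
move=> /(congr1 (mulmx J)); rewrite mulmx1 !mulmxA symp_mx_sq.
by rewrite !mulNmx mul1mx mulmxN mulNmx opprK.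
Qed.

Definition hyp_index (a : nat) : nat := if odd a then (g + a./2)%N else a./2.

Lemma hyp_index_lt (a : 'I_(g.*2)) : (hyp_index a < g + g)%N.
Proof. by rewrite /hyp_index; have := ltn_ord a; case: ifP; lia. Qed.

Definition hyp_ord (a : 'I_(g.*2)) : 'I_(g + g) := Ordinal (hyp_index_lt a).

Lemma hyp_ord_inj : injective hyp_ord.
Proof.
move=> a b /(congr1 val) /=; have := ltn_ord a; have := ltn_ord b.
move=> lt_b lt_a; rewrite /hyp_index => eq_ab; apply: val_inj => /=.
rewrite -(odd_double_half a) -(odd_double_half b).
by move: eq_ab; case: (odd a); case: (odd b); lia.
Qed.

(* The basis x_1, y_1, x_2, y_2, ... of H. *)
Definition hyp_basis : 'M[rat]_(g.*2, g + g) := \matrix_(a, b) (hyp_ord a == b)%:R.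

Lemma hyp_basisE a : row a hyp_basis = delta_mx 0 (hyp_ord a).
Proof. by apply/rowP => b; rewrite !mxE eq_sym. Qed.

Lemma hyp_basis_form : hyp_basis *m J *m hyp_basis^T = hyp_form rat g.
Proof.
apply/matrixP => a b.
transitivity (J (hyp_ord a) (hyp_ord b)).
  rewrite [LHS]mx_entryE [RHS]mx_entryE -!hyp_basisE !rowE trmx_mul.
  by rewrite !mulmxA.
have lt_half (c : 'I_(g.*2)) : (c./2 < g)%N by have := ltn_ord c; lia.
have := lt_half a; have := lt_half b; rewrite symp_mxE [RHS]mxE /= /hyp_index.
case: (odd a); case: (odd b) => /= lt_b lt_a; rewrite ?subrr ?if_same.
- by rewrite !ltn_eqF ?subrr //; lia.
- have -> : (b./2 == (g + (g + a./2))%N) = false by apply: ltn_eqF; lia.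
  by rewrite eqn_add2l !sub0r; case: eqP => _; rewrite ?oppr0.
- have -> : (a./2 == (g + (g + b./2))%N) = false by apply: ltn_eqF; lia.
  by rewrite eqn_add2l eq_sym !subr0; case: eqP.
- by rewrite !ltn_eqF ?subrr //; lia.
Qed.

Lemma hyp_basis_mul_tr : hyp_basis *m hyp_basis^T = 1%:M.
Proof.
apply/matrixP => a b; rewrite !mxE (bigD1 (hyp_ord a)) //= !mxE eqxx mul1r.
rewrite big1 ?addr0 => [|c /negPf neq_c]; last by rewrite !mxE eq_sym neq_c mul0r.
by rewrite eq_sym (inj_eq hyp_ord_inj).
Qed.

Lemma hyp_basis_tr_mul : hyp_basis^T *m hyp_basis = 1%:M.
Proof.
have [f fK Kf] : bijective hyp_ord.
  by apply: (inj_card_bij hyp_ord_inj); rewrite !card_ord addnn.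
apply/matrixP => a b; rewrite !mxE (bigD1 (f a)) //= !mxE Kf eqxx mul1r.
rewrite big1 ?addr0 // => c neq_c; rewrite !mxE -{1}(Kf a) (inj_eq hyp_ord_inj).
by rewrite (negPf neq_c) mul0r.
Qed.

End SymplecticMatrices.

(** * Invariants in the image of a Young symmetrizer *)

Lemma poly_vanish (f : {poly rat}) : (forall t, f.[t] = 0)%R -> f = 0%R.
Proof.
move=> f0; apply: (@roots_geq_poly_eq0 _ f [seq i%:R | i <- iota 0 (size f)])%R.
- by apply/allP => t _; rewrite /root f0.
- rewrite map_inj_uniq ?iota_uniq // => i j /eqP.
  by rewrite eqr_nat => /eqP.
- by rewrite size_map size_iota.
Qed.

Section InvariantBound.
Local Open Scope ring_scope.
Variables (g n : nat) (nu : young_diagram n).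
Local Notation J := (symp_mx g).
Local Notation rT := (tensor_repr (g + g) n).
Local Notation X0 := (hyp_basis g).

Section RowsInRange.
Variable rho : 'I_n -> 'I_(g.*2).
Hypothesis rhoE : forall p, rho p = box_row nu p :> nat.

Let F (v : 'rV_((g + g) ^ n)) M := tensor_eval v (rowsub rho M).

Let chi (L : 'M[rat]_(g.*2)) := \prod_p L (rho p) (rho p).

Variable w : 'rV[rat]_((g + g) ^ n).
Let v := w *m ysym rT nu.
Hypothesis v_inv : Sp_invariant v.

Let F_trig L M : is_trig_mx L -> F v (L *m M) = chi L * F v M.
Proof. exact: tensor_eval_trig. Qed.

Let F_Sp M S : Sp S -> F v (M *m S) = F v M.
Proof.
move=> SpS; rewrite /F -[in RHS](v_inv (Sp_tr SpS)) tensor_eval_ntensmx trmxK.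
by rewrite mul_rowsub_mx.
Qed.

(** Such an [A] is another symplectic basis, hence [X0] times the symplectic matrix [X0^T *m A]. *)
Let F_form A : A *m J *m A^T = hyp_form rat g -> F v A = F v X0.
Proof.
move=> A_form; have SpS : Sp (X0^T *m A).
  apply/SpP; rewrite trmx_mul trmxK !mulmxA -2!(mulmxA X0^T) A_form.
  rewrite -(hyp_basis_form g) !mulmxA hyp_basis_tr_mul mul1mx.
  by rewrite -mulmxA hyp_basis_tr_mul mulmx1.
by rewrite -(F_Sp X0 SpS) mulmxA hyp_basis_mul_tr mul1mx.
Qed.

Let det_neq0 (L : 'M[rat]_(g.*2)) : is_trig_mx L -> (forall i, L i i != 0) ->
  L \in unitmx.
Proof. by move=> L_trig L_i; rewrite unitmxE det_trig // unitfE; apply/prodf_neq0. Qed.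

(** The matrix D^-1 L M has the standard Gram matrix, and both [L] and [D] act on [F] by nonzero
    characters. *)
Let F_generic L D M : is_trig_mx L -> is_diag_mx D ->
    (forall i, L i i != 0) -> (forall i, D i i != 0) ->
    L *m (M *m J *m M^T) *m L^T = D *m hyp_form rat g *m D^T ->
  F v X0 = 0 -> F v M = 0.
Proof.
move=> L_trig D_diag L_i D_i LM_form F0.
have D_unit : D \in unitmx by apply: det_neq0 => //; apply: is_diag_mx_is_trig.
pose A := invmx D *m L *m M.
have DA : D *m A = L *m M by rewrite /A !mulmxA mulmxV // mul1mx.
have A_form : A *m J *m A^T = hyp_form rat g.
  rewrite /A !trmx_mul !mulmxA -!(mulmxA (invmx D)) !mulmxA.
  have -> : invmx D *m L *m M *m J *m M^T *m L^T *m (invmx D)^T =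
     invmx D *m (L *m (M *m J *m M^T) *m L^T) *m (invmx D)^T by rewrite !mulmxA.
  rewrite LM_form !mulmxA mulVmx // mul1mx -mulmxA -trmx_mul mulVmx //.
  by rewrite trmx1 mulmx1.
have : F v (L *m M) = 0.
  by rewrite -DA F_trig ?is_diag_mx_is_trig // F_form // F0 mulr0.
rewrite F_trig // => /eqP; rewrite mulf_eq0 => /orP[|/eqP //].
by have /negPf-> : chi L != 0 by apply/prodf_neq0.
Qed.

(** Elimination is applied along the segment from [X0] to [M]. Wherever the diagonal product [Q] is
    nonzero, [F_generic] gives f(t) = 0; hence f Q = 0 as a polynomial, so f = 0, and t = 1 is the
    claim. *)
Let F_zero : F v X0 = 0 -> forall M, F v M = 0.
Proof.
move=> F0 M.
pose Mt : 'M[{poly rat}]_(g.*2, g + g) :=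
  map_mx polyC X0 + 'X *: map_mx polyC (M - X0).
have Mt_eval t : map_mx (horner_eval t) Mt = X0 + t *: (M - X0).
  by apply/matrixP => a b; rewrite !mxE horner_evalE !hornerE.
pose G := Mt *m map_mx polyC J *m Mt^T.
have G_eval t : map_mx (horner_eval t) G =
    (X0 + t *: (M - X0)) *m J *m (X0 + t *: (M - X0))^T.
  rewrite /G !map_mxM -map_trmx Mt_eval; congr (_ *m _ *m _).
  by apply/matrixP => a b; rewrite [LHS]mxE /= horner_evalE [X in X.[_]]mxE hornerC.
have skewG : G^T = - G.
  rewrite /G !trmx_mul trmxK map_trmx.
  have -> : J^T = - J.
    by rewrite /symp_mx tr_block_mx opp_block_mx trmx0 trmx1 linearN /= trmx1 !oppr0 opprK.
  by rewrite map_mxN mulNmx mulmxN mulmxA.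
have G0 : map_mx (horner_eval 0) G = 1 *: hyp_form rat g.
  by rewrite G_eval !scale0r addr0 scale1r hyp_basis_form.
have [L [D [L_trig D_diag LD0 LGL]]] := skew_elimination (oner_neq0 _) skewG G0.
pose f := \sum_i (v 0 i)%:P * \prod_p Mt (rho p) (tidx i p).
have fE t : f.[t] = F v (X0 + t *: (M - X0)).
  rewrite horner_sum; apply: eq_bigr => i _; rewrite hornerM hornerC horner_prod.
  congr (_ * _); apply: eq_bigr => p _; rewrite -Mt_eval !mxE.
  by [].
pose Q := (\prod_i L i i) * \prod_i D i i.
have Q_neq0 : Q != 0.
  apply: contraTneq (oner_neq0 rat) => Q0; rewrite negbK.
  have : Q.[0] != 0.
    by rewrite hornerM !horner_prod mulf_neq0 //; apply/prodf_neq0 => i _; case: (LD0 i).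
  by rewrite Q0 horner0 eqxx.
have /eqP : f * Q = 0.
  apply: poly_vanish => t; rewrite hornerM fE.
  have [Qt0|Qt] := eqVneq Q.[t] 0; first by rewrite Qt0 mulr0.
  rewrite (@F_generic (map_mx (horner_eval t) L) (map_mx (horner_eval t) D)) ?mul0r //.
  - apply/is_trig_mxP => a b lt_ab.
    by rewrite mxE (is_trig_mxP L_trig) // horner_evalE horner0.
  - apply/is_diag_mxP => a b neq_ab.
    by rewrite mxE (is_diag_mxP D_diag) // horner_evalE horner0.
  - move=> i; apply: contraNneq Qt; rewrite mxE horner_evalE => Li0.
    by rewrite hornerM horner_prod (bigD1 i) //= Li0 !mul0r.
  - move=> i; apply: contraNneq Qt; rewrite mxE horner_evalE => Di0.
    by rewrite hornerM mulrC horner_prod (bigD1 i) //= Di0 !mul0r.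
  rewrite -G_eval !map_trmx -!map_mxM LGL !map_mxM; congr (_ *m _ *m _).
  apply/matrixP => a b; rewrite !mxE /= horner_evalE.
  by case: ifP => _; rewrite ?horner0 // hornerD hornerN -!polyC_natr !hornerC.
rewrite mulf_eq0 (negPf Q_neq0) orbF => /eqP f0.
have := fE 1; rewrite f0 horner0 scale1r addrC subrK.
by move<-.
Qed.

Lemma invariant_ysym_eq0 : tensor_eval v (rowsub rho X0) = 0 -> v = 0.
Proof.
move=> /F_zero F0; apply: (tensor_eval_polar (f := rho)) F0 => s.
rewrite (colour_stab_rho rhoE) /v /ysym !mulmxA => s_row.
by rewrite -!mulmxA ysum_mulr // psign_sym scale1r.
Qed.

(* F is multiplied by 2^(nu_2r - nu_(2r+1)) under the symplectic change of basis
   that scales the r-th hyperbolic pair by (2, 1/2). *)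
Lemma invariant_ysym_shape r : v != 0 -> (r < g)%N ->
  nth 0%N nu r.*2 = nth 0%N nu r.*2.+1.
Proof.
move=> nz_v lt_r; have lt_r0 : (r.*2 < g.*2)%N by rewrite ltn_double.
have lt_r1 : (r.*2.+1 < g.*2)%N by lia.
pose d (a : nat) : rat := if a == r.*2 then 2 else if a == r.*2.+1 then 2^-1 else 1.
have d_pair s : d s.*2 * d s.*2.+1 = 1.
  rewrite /d eqSS; have [->|neq_s] := eqVneq s r.
    by rewrite eqxx gtn_eqF ?mulfV.
  have -> : (s.*2 == r.*2) = false by apply/eqP; lia.
  have -> : (s.*2 == r.*2.+1) = false by apply/eqP; lia.
  have -> : (s.*2.+1 == r.*2) = false by apply/eqP; lia.
  by rewrite mulr1.
pose D : 'M[rat]_(g.*2) := diag_mx (\row_a d a).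
have D_form : D *m X0 *m J *m (D *m X0)^T = hyp_form rat g.
  rewrite trmx_mul !mulmxA -2!(mulmxA D) hyp_basis_form tr_diag_mx.
  apply/matrixP => a b; rewrite mul_mx_diag mul_diag_mx !mxE.
  case: (eqVneq a./2 b./2) => [eq_ab|]; last by rewrite mulr0 mul0r.
  rewrite -[in d a](odd_double_half a) -[in d b](odd_double_half b) -eq_ab.
  case: (odd a); case: (odd b); rewrite /= ?add0n ?add1n ?subrr ?mulr0 ?mul0r //.
    by rewrite sub0r mulrN1 mulNr [X in - X]mulrC d_pair.
  by rewrite subr0 mulr1 d_pair.
have nz_F : F v X0 != 0 by apply: contraNneq nz_v => /invariant_ysym_eq0->.
have /eqP : F v X0 = chi D * F v X0 by rewrite -F_trig ?diag_mx_is_trig // F_form.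
rewrite -{1}[F v X0]mul1r (inj_eq (mulIf nz_F)) => /eqP.
have chiE s (c : rat) : \prod_p (if box_row nu p == s then c else 1) = c ^+ nth 0%N nu s.
  by rewrite -big_mkcond prodr_const card_box_row.
have -> : chi D = 2 ^+ nth 0%N nu r.*2 * 2^-1 ^+ nth 0%N nu r.*2.+1.
  rewrite -!chiE -big_split; apply: eq_bigr => p _; rewrite !mxE eqxx mulr1n rhoE /d.
  have [->|_] := eqVneq (box_row nu p) r.*2; first by rewrite ltn_eqF ?mulr1.
  by rewrite /= mul1r.
have nz2 : 2 ^+ nth 0%N nu r.*2.+1 != 0 :> rat by rewrite expf_neq0.
move/eqP; rewrite exprVn eq_sym -(inj_eq (mulIf nz2)).
by rewrite mulfVK // mul1r -!natrX eqr_nat eqn_exp2l // => /eqP.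
Qed.

End RowsInRange.

Lemma invariant_ysym_height (w : 'rV[rat]_((g + g) ^ n)) :
  w *m ysym rT nu != 0 -> (size nu <= g.*2)%N.
Proof.
move=> nz_v; rewrite leqNgt -addnn; apply: contra nz_v => lt_size.
by rewrite /ysym mulmxA ycol_tensor_eq0 // mul0mx.
Qed.

Lemma row_ord_ex : (size nu <= g.*2)%N ->
  exists rho : 'I_n -> 'I_(g.*2), forall p, rho p = box_row nu p :> nat.
Proof.
move=> le_size; have lt_row p : (box_row nu p < g.*2)%N.
  by apply: leq_trans le_size; rewrite -nth_diagram_gt0 (leq_ltn_trans _ (box_col_lt nu p)).
by exists (fun p => Ordinal (lt_row p)).
Qed.

Lemma invariant_ysym_pairs (w : 'rV[rat]_((g + g) ^ n)) r :
  Sp_invariant (w *m ysym rT nu) -> w *m ysym rT nu != 0 -> (r < g)%N ->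
  nth 0%N nu r.*2 = nth 0%N nu r.*2.+1.
Proof.
move=> v_inv nz_v; have [rho rhoE] := row_ord_ex (invariant_ysym_height nz_v).
exact: (invariant_ysym_shape rhoE v_inv).
Qed.

(** The factor is the ratio of the values at [X0]: the difference is again an invariant in the
    image, and its value there is zero. *)
Lemma invariant_ysym_colinear (w w' : 'rV[rat]_((g + g) ^ n)) :
    Sp_invariant (w *m ysym rT nu) -> Sp_invariant (w' *m ysym rT nu) ->
    w *m ysym rT nu != 0 ->
  exists a, w' *m ysym rT nu = a *: (w *m ysym rT nu).
Proof.
move=> v_inv v'_inv nz_v; have [rho rhoE] := row_ord_ex (invariant_ysym_height nz_v).
pose F (u : 'rV_((g + g) ^ n)) := tensor_eval u (rowsub rho X0).
have nz_F : F (w *m ysym rT nu) != 0.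
  by apply: contraNneq nz_v => /(invariant_ysym_eq0 rhoE v_inv)->.
pose a := F (w' *m ysym rT nu) / F (w *m ysym rT nu); exists a.
have diffE : (w' - a *: w) *m ysym rT nu =
    w' *m ysym rT nu - a *: (w *m ysym rT nu) by rewrite mulmxBl scalemxAl.
apply/eqP; rewrite -subr_eq0 -diffE; apply/eqP/(invariant_ysym_eq0 rhoE).
  by move=> A SpA; rewrite diffE mulmxBl -scalemxAl v_inv ?v'_inv.
by rewrite diffE tensor_evalB tensor_evalZ -/(F _) -/(F _) divfK // subrr.
Qed.

End InvariantBound.

(** * The domino tensor *)

Section MatchingSign.
Local Open Scope ring_scope.
Variables (T : finType) (tau : {perm T}) (E : pred T).
Hypothesis tauK : involutive tau.
Hypothesis E_tau : forall p, E (tau p) = ~~ E p.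

(** Such a [q] acts on [E] and on its complement by permutations conjugate under [tau], whose signs
    cancel. *)
Lemma sign_matching_preserving (q : {perm T}) :
    (forall p, q (tau p) = tau (q p)) -> (forall p, E p -> E (q p)) -> odd_perm q = false.
Proof.
move=> q_tau q_E.
have q_E' p : E (q p) = E p.
  apply/idP/idP; last exact: q_E.
  by apply: contraLR => Ep; rewrite -E_tau -q_tau q_E // E_tau.
pose f1 p := if E p then q p else p.
have f1_inj : injective f1.
  move=> p p'; rewrite /f1; case: ifP => Ep; case: ifP => Ep' //.
  - exact: perm_inj.
  - by move=> eq_p; rewrite -eq_p q_E' Ep in Ep'.
  - by move=> eq_p; rewrite eq_p q_E' Ep' in Ep.
pose q1 := perm f1_inj.
have -> : q = (q1 * q1 ^ tau)%g.
  have tauV : (tau^-1)%g = tau.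
    by apply/permP => p; apply: (@perm_inj _ tau); rewrite permKV tauK.
  apply/permP => p; rewrite conjgE tauV !permM !permE /f1.
  by case Ep: (E p); rewrite E_tau ?q_E' Ep /= ?q_tau ?tauK.
by rewrite odd_permM odd_permJ addbb.
Qed.

(** Induction on the number of pairs reversed by [q]: composing with the exchange of one such pair
    changes both the sign of [q] and one factor of the product. *)
Lemma sign_matching (q : {perm T}) : (forall p, q (tau p) = tau (q p)) ->
  (-1) ^+ q * \prod_(p | E p) (-1) ^+ (~~ E (q p)) = 1 :> rat.
Proof.
move: {2}#|_| (leqnn #|[pred p | E p && ~~ E (q p)]|) => N.
elim: N q => [|N IHN] q le_N q_tau.
  move: le_N; rewrite leqn0 => /eqP/card0_eq no_flip.
  have q_E p : E p -> E (q p).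
    by move=> Ep; have := no_flip p; rewrite !inE Ep /= => /negbFE.
  by rewrite (sign_matching_preserving q_tau q_E) mul1r big1 // => p /q_E->.
have [no_flip|] := posnP #|[pred p | E p && ~~ E (q p)]|.
  by apply: IHN; rewrite // no_flip.
case/card_gt0P => e /andP[Ee Eqe].
have neq_e : e != tau e.
  by apply/eqP => eq_e; have := E_tau e; rewrite -eq_e Ee.
pose q' := (tperm e (tau e) * q)%g.
have q'_e : q' e = tau (q e) by rewrite permM tpermL q_tau.
have q'_other p : E p -> p != e -> q' p = q p.
  move=> Ep neq_p; rewrite permM tpermD // eq_sym //.
  by apply: contraTneq Ep => ->; rewrite E_tau Ee.
have q'_tau p : q' (tau p) = tau (q' p).
  rewrite !permM -q_tau; congr (q _).
  case: (tpermP e (tau e) p) => [->|->|/eqP p_e /eqP p_te]; rewrite ?tpermR ?tauK ?tpermL //.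
  by rewrite tpermD // eq_sym (can2_eq tauK tauK) // tauK.
have q_q' : (-1) ^+ q = - (-1) ^+ q' :> rat.
  by rewrite odd_permM odd_tperm neq_e /= signrN opprK.
have lt_N : (#|[pred p | E p && ~~ E (q' p)]| <= N)%N.
  rewrite -ltnS; apply: leq_trans le_N; apply: proper_card.
  apply/properP; split; last first.
    by exists e; rewrite !inE Ee ?Eqe // q'_e E_tau Eqe.
  apply/subsetP => p; rewrite !inE => /andP[Ep].
  have [->|neq_p] := eqVneq p e; first by rewrite q'_e E_tau Eqe.
  by rewrite q'_other // Ep.
rewrite -[RHS](IHN q' lt_N q'_tau) q_q' (bigD1 e) //= Eqe [in RHS](bigD1 e) //=.
rewrite q'_e E_tau Eqe expr1 expr0 mul1r mulN1r mulrNN; congr (_ * _).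
by apply: eq_bigr => p /andP[Ep neq_p]; rewrite q'_other.
Qed.

End MatchingSign.

(** * An invariant from copies of the symplectic form on vertical dominoes *)

Section DominoTensor.
Local Open Scope ring_scope.
Variables (g n : nat) (nu : young_diagram n).
Hypothesis nu_pairs : forall r, nth 0%N nu r.*2 = nth 0%N nu r.*2.+1.

Local Notation J := (symp_mx g).
Local Notation rT := (tensor_repr (g + g) n).
Local Notation X0 := (hyp_basis g).

Definition flip (r : nat) := if odd r then r.-1 else r.+1.

Let flip_half r : (flip r)./2 = r./2.
Proof. by rewrite /flip; case: ifP; lia. Qed.

Let flip_odd r : odd (flip r) = ~~ odd r.
Proof. by rewrite /flip; case: ifP; lia. Qed.

Let half_odd_inj r r' : r./2 = r'./2 -> odd r = odd r' -> r = r'.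
Proof. by move=> eq_h eq_o; rewrite -(odd_double_half r) eq_h eq_o odd_double_half. Qed.

Let nth_flip r : nth 0%N nu (flip r) = nth 0%N nu r.
Proof.
case odd_r: (odd r); rewrite /flip odd_r.
  have -> : r = (r./2).*2.+1 by lia.
  by rewrite /= nu_pairs.
have -> : r = (r./2).*2 by lia.
by rewrite nu_pairs.
Qed.

Lemma domino_ex : exists tau : 'S_n, involutive tau /\ forall p,
  box_row nu (tau p) = flip (box_row nu p) /\ box_col nu (tau p) = box_col nu p.
Proof.
have ex_p p : exists q, (box_row nu q == flip (box_row nu p)) && (box_col nu q == box_col nu p).
  have [|q [rq cq]] := @box_ex _ nu (flip (box_row nu p)) (box_col nu p); last first.
    by exists q; rewrite rq cq !eqxx.
  by rewrite nth_flip box_col_lt.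
pose f p := xchoose (ex_p p).
have f_row p : box_row nu (f p) = flip (box_row nu p) by have /andP[/eqP] := xchooseP (ex_p p).
have f_col p : box_col nu (f p) = box_col nu p by have /andP[_ /eqP] := xchooseP (ex_p p).
have fK : involutive f.
  move=> p; apply: (@box_inj _ nu); rewrite ?f_col // !f_row.
  by apply: half_odd_inj; rewrite ?flip_half // !flip_odd negbK.
exists (perm (can_inj fK)); split=> [p|p]; rewrite !permE //.
Qed.

Variable tau : 'S_n.
Hypothesis tauK : involutive tau.
Hypothesis tau_row : forall p, box_row nu (tau p) = flip (box_row nu p).
Hypothesis tau_col : forall p, box_col nu (tau p) = box_col nu p.

Let E (p : 'I_n) := ~~ odd (box_row nu p).

Let E_tau p : E (tau p) = ~~ E p.
Proof. by rewrite /E tau_row flip_odd. Qed.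

Definition domino_tensor : 'rV[rat]_((g + g) ^ n) :=
  \row_i \prod_(p | E p) J (tidx i p) (tidx i (tau p)).

Lemma domino_tensor_eval w :
  tensor_eval domino_tensor w = \prod_(p | E p) (w *m J *m w^T) p (tau p).
Proof.
rewrite /tensor_eval (reindex (@tensor_index (g + g) n)) /=; last first.
  by exists (@tidx (g + g) n) => i _; rewrite ?tidxK ?tensor_indexK.
pose m := (g + g)%N.
pose G (p : 'I_n) (ab : 'I_m * 'I_m) := w p ab.1 * J ab.1 ab.2 * w (tau p) ab.2.
transitivity (\sum_(i : {ffun 'I_n -> 'I_m}) \prod_(p | E p) G p (i p, i (tau p))).
  apply: eq_bigr => i _; rewrite mxE tensor_indexK.
  rewrite [X in _ * X](bigID E) /= [X in _ * (_ * X)](reindex_inj (@perm_inj _ tau)) /=.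
  under [X in _ * (_ * X)]eq_bigl => p do rewrite E_tau negbK.
  by rewrite -!big_split; apply: eq_bigr => p _; rewrite /G /= mulrCA mulrA.
pose dom := {p : 'I_n | E p}.
have to_E p : E (if E p then p else tau p).
  by case Ep: (E p); rewrite // E_tau Ep.
have [half val_half] : exists half : 'I_n -> dom,
    forall p, val (half p) = if E p then p else tau p.
  by exists (fun p => Sub _ (to_E p)).
have half1 (e : dom) : half (val e) = e.
  by apply: val_inj; rewrite val_half (valP e).
have half2 (e : dom) : half (tau (val e)) = e.
  by apply: val_inj; rewrite val_half E_tau (valP e) /= tauK.
(* A multi-index is the same as a pair of indices on each domino, so the sum factors over the
   dominoes. *)
pose lower (f : {ffun dom -> 'I_m * 'I_m}) : {ffun 'I_n -> 'I_m} :=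
  [ffun p => if E p then (f (half p)).1 else (f (half p)).2].
have lowerE f (e : dom) : (lower f (val e), lower f (tau (val e))) = f e.
  by rewrite !ffunE E_tau (valP e) /= half1 half2 -surjective_pairing.
rewrite (reindex lower) /=; last first.
  exists (fun i => [ffun e : dom => (i (val e), i (tau (val e)))]) => [f _|i _].
    by apply/ffunP => e; rewrite ffunE lowerE.
  apply/ffunP => p; rewrite !ffunE /= val_half; case Ep: (E p) => //=.
  by rewrite tauK.
transitivity (\sum_(f : {ffun dom -> 'I_m * 'I_m}) \prod_(e : dom) G (val e) (f e)).
  by apply: eq_bigr => f _; rewrite big_sub; apply: eq_bigr => e _; rewrite lowerE.
transitivity (\prod_(e : dom) \sum_ab G (val e) ab); first by rewrite bigA_distr_bigA.
rewrite [RHS]big_sub; apply: eq_bigr => e _.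
rewrite -(pair_bigA _ (fun a b => G (val e) (a, b))) /= [RHS]mxE exchange_big /=.
apply: eq_bigr => b _; rewrite [X in _ = X * _]mxE [X in _ = _ * X]mxE mulr_suml.
by apply: eq_bigr => a _.
Qed.

Lemma tensor_eval_inj (u v : 'rV[rat]_((g + g) ^ n)) :
  (forall w, tensor_eval u w = tensor_eval v w) -> u = v.
Proof.
move=> eq_uv; apply/eqP; rewrite -subr_eq0; apply/eqP.
apply: (@tensor_eval_polar _ _ _ n id) => [s /colour_stabP s_id|M].
  have -> : s = 1%g by apply/permP => p; rewrite perm1 s_id.
  by rewrite repr_mx1 mulmx1.
by rewrite tensor_evalB eq_uv subrr.
Qed.

Lemma domino_tensor_inv : Sp_invariant domino_tensor.
Proof.
move=> A /Sp_tr/SpP A_J; rewrite trmxK in A_J; apply: tensor_eval_inj => w.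
rewrite tensor_eval_ntensmx !domino_tensor_eval; apply: eq_bigr => p _.
by rewrite trmx_mul trmxK !mulmxA -2!(mulmxA w) A_J.
Qed.

(** At the symplectic basis, a column permutation with a nonzero term maps dominoes to dominoes, so
    by [sign_matching] its sign cancels the signs of the form. All terms are 0 or 1, and the
    identity gives 1. *)
Lemma domino_tensor_ysym_neq0 : (size nu <= g.*2)%N ->
  domino_tensor *m ysym rT nu != 0.
Proof.
move=> nu_size; have [rho rhoE] := row_ord_ex nu_size.
suff : 0 < tensor_eval (domino_tensor *m ysym rT nu) (rowsub rho X0).
  apply: contraTneq => ->; rewrite /tensor_eval big1 ?ltxx // => i _.
  by rewrite mxE mul0r.
rewrite tensor_eval_ysym_row // mulr_gt0 ?card_colour_stab_gt0 //.
rewrite tensor_eval_ysum.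
have term q : tensor_eval domino_tensor (row_perm q (rowsub rho X0)) =
    \prod_(p | E p) hyp_form rat g (rho (q p)) (rho (q (tau p))).
  rewrite domino_tensor_eval; apply: eq_bigr => p _.
  rewrite -(hyp_basis_form g) [LHS]mx_entryE [RHS]mx_entryE !mulmxA.
  have rowE' p' : (delta_mx 0 p' : 'rV[rat]_n) *m row_perm q (rowsub rho X0) =
      (delta_mx 0 (rho (q p')) : 'rV[rat]_(g.*2)) *m X0.
    by rewrite -!rowE; apply/rowP => a; rewrite !mxE.
  by rewrite rowE' -!(mulmxA _ _ (delta_mx _ _)^T) -!trmx_mul rowE'.
rewrite (bigD1 1%g) ?group1 //= ltr_wpDr //.
  apply: sumr_ge0 => q /andP[/colour_stabP q_col _]; rewrite term.
  have [->|nz] := eqVneq (\prod_(p | E p) hyp_form rat g (rho (q p)) (rho (q (tau p)))) 0.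
    by rewrite mulr0.
  have q_half p : E p -> (box_row nu (q (tau p)))./2 = (box_row nu (q p))./2.
    move=> Ep; move/prodf_neq0: nz => /(_ p Ep); rewrite mxE !rhoE.
    by case: (eqVneq (box_row nu (q p))./2) => // _; rewrite eqxx.
  have q_odd p : E p -> odd (box_row nu (q (tau p))) = ~~ odd (box_row nu (q p)).
    move=> Ep; move/prodf_neq0: nz => /(_ p Ep); rewrite mxE !rhoE q_half // eqxx.
    by case: (odd _); case: (odd _); rewrite ?subrr ?eqxx.
  have q_tau_E p : E p -> q (tau p) = tau (q p).
    move=> Ep; apply: (@box_inj _ nu); last by rewrite q_col !tau_col q_col.
    by apply: half_odd_inj; rewrite tau_row ?flip_half ?flip_odd ?q_half ?q_odd.
  have q_tau p : q (tau p) = tau (q p).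
    case Ep: (E p); first exact: q_tau_E.
    by rewrite -[p in RHS]tauK (q_tau_E (tau p)) ?E_tau ?Ep // tauK.
  rewrite (_ : psign _ _ * _ = 1) //.
  rewrite -[RHS](sign_matching tauK E_tau q_tau); congr (_ * _).
  apply: eq_bigr => p Ep; rewrite mxE !rhoE q_half // eqxx q_odd // /E negbK.
  by case: (odd _); rewrite ?subr0 ?sub0r ?expr1.
rewrite psign1 mul1r term big1 // => p Ep; rewrite !perm1 mxE !rhoE tau_row.
have /negPf odd_p : ~~ odd (box_row nu p) := Ep.
by rewrite flip_half eqxx flip_odd odd_p subr0.
Qed.

End DominoTensor.

(** * The dimension formula *)

Section DoubledDiagrams.

Lemma size_double_rows s : size (double_rows s) = (size s).*2.
Proof. by elim: s => [|r s IHs] //=; rewrite -/(double_rows s) IHs doubleS. Qed.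

Lemma nth_double_rows s i : nth 0 (double_rows s) i = nth 0 s i./2.
Proof.
by elim: s i => [|r s IHs] [|[|i]] //=; rewrite ?nth_nil // -/(double_rows s) IHs.
Qed.

Lemma sumn_double_rows s : sumn (double_rows s) = (sumn s).*2.
Proof. by elim: s => [|r s IHs] //=; rewrite -/(double_rows s) IHs; lia. Qed.

Lemma delta_inj k : injective (@delta k).
Proof.
move=> la mu eq_d; apply: eq_diagram => r.
have := congr1 (fun nu : young_diagram (2 * k) => nth 0 nu r.*2) eq_d.
by rewrite /= !nth_double_rows doubleK.
Qed.

Lemma delta_ex k g (nu : young_diagram (2 * k)) : size nu <= g.*2 ->
    (forall r, r < g -> nth 0 nu r.*2 = nth 0 nu r.*2.+1) ->
  exists2 la : young_diagram k, delta la = nu & height la <= g.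
Proof.
move=> le_size nu_pairs; pose h := (size nu)./2.
have size_h : size nu = h.*2.
  (* With an odd number of rows, the last row would be paired with an empty one. *)
  rewrite -[LHS]odd_double_half; case odd_size: (odd (size nu)) => //.
  have lt_h : h < g by rewrite /h; lia.
  have := nu_pairs h lt_h; rewrite [RHS]nth_default; last by rewrite /h; lia.
  by move=> nth0; have := nth_diagram_gt0 nu h.*2; rewrite nth0 /h; lia.
have nth_nu i : nth 0 nu (i./2).*2 = nth 0 nu i.
  rewrite -[in RHS](odd_double_half i); case: (odd i); rewrite ?add0n // add1n.
  case: (ltnP i./2 g) => [/nu_pairs //|le_g]; rewrite !nth_default //; lia.
pose rows := mkseq (fun r => nth 0 nu r.*2) h.
have double_rowsE : double_rows rows = nu.
  apply: (@eq_from_nth _ 0) => [|i]; rewrite size_double_rows size_mkseq ?size_h // => lt_i.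
  by rewrite nth_double_rows nth_mkseq ?nth_nu //; lia.
have rows_diagram : is_young_diagram k rows.
  apply/and3P; split.
  - apply/(sortedP 0) => r; rewrite size_mkseq => lt_r.
    by rewrite !nth_mkseq ?(ltnW lt_r) //; apply: nth_diagram_leq; lia.
  - apply/mapP => -[r]; rewrite mem_iota => /andP[_ lt_r] nth0.
    by have := nth_diagram_gt0 nu r.*2; rewrite -nth0 size_h; lia.
  - have := sumn_double_rows rows; rewrite double_rowsE sumn_diagram; lia.
exists (YoungDiagram rows_diagram); first exact: val_inj.
by rewrite /height /= size_mkseq /h; lia.
Qed.

End DoubledDiagrams.

Section VspaceMatrix.
Local Open Scope ring_scope.

Lemma vspace_mx_ex (F : fieldType) d (U : {vspace 'rV[F]_d}) :
  exists M : 'M[F]_(\dim U, d),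
    \rank M = \dim U /\ forall v : 'rV_d, (v <= M)%MS = (v \in U).
Proof.
pose M : 'M[F]_(\dim U, d) := \matrix_i (vbasis U)`_i; exists M.
have mulM z : z *m M = \sum_i z 0 i *: (vbasis U)`_i.
  by rewrite mulmx_sum_row; apply: eq_bigr => i _; rewrite rowK.
split.
  apply/eqP; rewrite -/(row_free M) -kermx_eq0; apply/rowV0P => z /sub_kermxP.
  have /freeP b_free := basis_free (vbasisP U); rewrite mulM => /b_free z0.
  by apply/rowP => i; rewrite z0 mxE.
move=> v; apply/submxP/idP => [[z ->]|vU].
  rewrite mulM; apply: memv_suml => i _; apply: memvZ.
  by apply: vbasis_mem; rewrite mem_nth ?size_tuple.
exists (\row_i coord (vbasis U) i v); rewrite mulM {1}(coord_vbasis vU).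
by apply: eq_bigr => i _; rewrite mxE.
Qed.

End VspaceMatrix.

(** * Decomposition of the space of invariants *)

Section Assembly.
Local Open Scope ring_scope.
Variables (g k : nat).
Local Notation n := (2 * k)%N.
Local Notation rT := (tensor_repr (g + g) n).

Lemma Sp_invariant_perm (v : 'rV_((g + g) ^ n)) s :
  Sp_invariant v -> Sp_invariant (v *m rT s).
Proof.
by move=> v_inv A SpA; rewrite -mulmxA -ntensmx_tensor_repr mulmxA v_inv.
Qed.

Lemma Sp_invariant_ysym (v : 'rV_((g + g) ^ n)) nu :
  Sp_invariant v -> Sp_invariant (v *m ysym rT nu).
Proof.
have ysum_inv sg (T : eqType) (f : 'I_n -> T) (u : 'rV_((g + g) ^ n)) :
    Sp_invariant u -> Sp_invariant (u *m ysum rT sg f).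
  move=> u_inv A SpA; rewrite /ysum mulmx_sumr mulmx_suml.
  apply: eq_bigr => s _; rewrite -scalemxAr -scalemxAl.
  by rewrite Sp_invariant_perm.
by move=> v_inv; rewrite /ysym mulmxA; apply/ysum_inv/ysum_inv.
Qed.

(** The height bound stands under the existential so that one tensor can be chosen for every
    diagram, with the default 0 for the tall ones. *)
Lemma delta_invariant_ex (la : young_diagram k) :
  exists th : 'rV[rat]_((g + g) ^ n), (height la <= g)%N ->
    Sp_invariant th /\ th *m ysym rT (delta la) != 0.
Proof.
case: (leqP (height la) g) => [le_g|]; last by exists 0.
have pairs r : nth 0%N (delta la) r.*2 = nth 0%N (delta la) r.*2.+1.
  by rewrite /= !nth_double_rows doubleK /= uphalf_double.
have size_le : (size (delta la) <= g.*2)%N.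
  by rewrite /= size_double_rows leq_double.
have [tau [tauK tau_box]] := domino_ex pairs.
exists (domino_tensor g (delta la) tau) => _; split.
  by apply: (@domino_tensor_inv _ _ (delta la)) => // p; case: (tau_box p).
by apply: domino_tensor_ysym_neq0 => // p; case: (tau_box p).
Qed.

Lemma dim_Sp_invariants :
  \dim (Sp_invariants g n) =
  (\sum_(la : young_diagram k | (height la <= g)%N) \rank (specht_module (delta la)))%N.
Proof.
have [th thP] := fin_all_exists delta_invariant_ex.
have [V [rankV V_mem]] := vspace_mx_ex (Sp_invariants g n).
have V_inv v : (v <= V)%MS <-> Sp_invariant v by rewrite V_mem; apply: Sp_invariantsP.
pose Wi la := cyclic_mx rT (th la *m ysym rT (delta la)).
pose W := (\sum_(la | (height la <= g)%N) Wi la)%MS.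
have rT_orth : orthogonal_repr rT := @tensor_repr_orthogonal (g + g) n.
have rankW : \rank W = (\sum_(la : young_diagram k | (height la <= g)%N)
    \rank (specht_module (delta la)))%N.
  have := mxdirect_cyclic_ysym (fun la : young_diagram k => height la <= g)%N th
     rT_orth (@delta_inj k).
  move=> /mxdirectP /= ->; apply: eq_bigr => la /thP[_ nz_th].
  by rewrite (rank_specht_module rT_orth nz_th).
rewrite -rankW -rankV.
have V_stab s : (V *m rT s <= V)%MS.
  apply/row_subP => i; rewrite row_mul; apply/V_inv/Sp_invariant_perm/V_inv.
  exact: row_sub.
have W_stab s : (W *m rT s <= W)%MS.
  have : mxmodule rT W by apply: sumsmx_module => la _; apply: cyclic_mx_module.
  by move=> /mxmoduleP/(_ s (in_setT s)).
have sWV : (W <= V)%MS.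
  apply/sumsmx_subP => la le_g; apply: cyclic_mx_sub; first by apply/mxmoduleP => s _.
  by apply/V_inv/Sp_invariant_ysym; case: (thP la le_g).
apply/eqP; rewrite eqn_leq (mxrankS sWV) andbT.
pose U := (V :&: kermx W^T)%MS.
have U_stab s : (U *m rT s <= U)%MS.
  rewrite sub_capmx (submx_trans _ (V_stab s)) ?submxMr ?capmxSl //=.
  apply/sub_kermxP; have /submxP[X WX] := W_stab s^-1%g.
  have UW : U *m W^T = 0 by apply/sub_kermxP; apply: capmxSr.
  rewrite -(invgK s) -rT_orth -mulmxA -trmx_mul WX trmx_mul mulmxA UW.
  exact: mul0mx.
(* A nonzero [U], the orthogonal complement of [W] in [V], would contain a nonzero symmetrized
   invariant; that vector is proportional to a generator of [W], hence orthogonal to itself. *)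
have U0 : U = 0.
  apply/eqP; apply/negPn/negP => /(ysym_complete rT_orth U_stab)[nu [x [Ux nz_xC]]].
  have x_inv : Sp_invariant x by apply/V_inv; apply: submx_trans Ux (capmxSl _ _).
  have xC_inv := Sp_invariant_ysym nu x_inv.
  have [la eq_nu le_g] := delta_ex (invariant_ysym_height nz_xC)
    (fun r => invariant_ysym_pairs xC_inv nz_xC).
  have [th_inv nz_th] := thP la le_g; rewrite eq_nu in nz_th.
  have [a xC] := invariant_ysym_colinear (Sp_invariant_ysym nu th_inv) xC_inv nz_th.
  have xC_W : (x *m ysym rT nu <= W)%MS.
    rewrite xC scalemx_sub // -eq_nu.
    by apply: (submx_trans (cyclic_mx_id rT _)); apply: (sumsmx_sup la).
  have xC_U : (x *m ysym rT nu <= U)%MS.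
    have ysum_U sg (T : eqType) (f : 'I_n -> T) (u : 'rV_((g + g) ^ n)) :
        (u <= U)%MS -> (u *m ysum rT sg f <= U)%MS.
      move=> Uu; rewrite /ysum mulmx_sumr summx_sub // => s _.
      rewrite -scalemxAr scalemx_sub //.
      by apply: submx_trans (U_stab s); apply: submxMr.
    by rewrite /ysym mulmxA; apply/ysum_U/ysum_U.
  have /submxP[z xC_z] := xC_W.
  have xC_perp : (x *m ysym rT nu) *m W^T = 0.
    by apply/sub_kermxP; apply: submx_trans xC_U (capmxSr _ _).
  case/eqP: nz_xC; apply/eqP; rewrite -dot_eq0 /dot {2}xC_z trmx_mul mulmxA xC_perp.
  by rewrite mul0mx mxE.
(* As [V] meets the complement of [W] trivially, their ranks add up to at most that of the whole
   space, so the rank of [V] is at most that of [W]. *)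
have := mxrank_sum_cap V (kermx W^T); rewrite -/U U0 mxrank0 addn0 mxrank_ker mxrank_tr.
have := rank_leq_col (V + kermx W^T)%MS; have := rank_leq_col W; lia.
Qed.

End Assembly.

Theorem corollary1p2 (g k : nat) (hg : (1 <= g)%N) (hk : (1 <= k)%N) :
  \dim (Sp_invariants g (2 * k)) =
  (\sum_(la : young_diagram k | (height la <= g)%N)
    repr_dim (specht_repr (delta la)))%N.
Proof. exact: dim_Sp_invariants. Qed.
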